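(* Let $f,g\in\mathrm{Diff}(\mathbb{C},0)$ have periods $k,l\in\mathbb{N}^*$ respectively, i.e. $f^k=\mathrm{id}$ and $g^l=\mathrm{id}$ on a neighborhood of $0$. Then, for $h$ belonging to some $G_\delta$-dense set $\mathcal{H}\subset\mathrm{Diff}(\mathbb{C},0)$ (for the analytic topology), the group generated by $f$ and $h^{-1}\circ g\circ h$ in the group of germs $\mathrm{Diff}(\mathbb{C},0)$ is isomorphic to the group with presentation $\langle a,b\,;\,a^k=b^l=\mathrm{id}\rangle$.
   Context: $\mathrm{Diff}(\mathbb{C},0)$ is the group of germs of holomorphic diffeomorphisms of $\mathbb{C}$ fixing $0$. The period of $f$ is its order as a germ. Analytic topology: for $r>0$ and $h$ holomorphic near $0$, $\|h\|_r=\sup_{B(r)}|h|$ if $h$ extends holomorphically to the open disc $B(r)$ of radius $r$, and $+\infty$ otherwise; a basis of open sets is given by $\{g:\|g-f\|_r<\varepsilon\}$, $f\in\mathrm{Diff}(\mathbb{C},0)$, $r,\varepsilon>0$. A $G_\delta$-dense set is a countable intersection of open dense sets. *)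

(* Defs.v *)
From Stdlib Require Import Reals List.
From Coquelicot Require Import Coquelicot.
Open Scope R_scope.

Definition disc (r : R) (z : C) : Prop := Cmod z < r.

Definition holo_on (D : C -> Prop) (phi : C -> C) : Prop :=
  forall z, D z -> exists l : C, @is_derive C_AbsRing C_NormedModule phi z l.

Definition holo_near0 (phi : C -> C) : Prop :=
  exists r, 0 < r /\ holo_on (disc r) phi.

Definition germ_eq (u v : C -> C) : Prop :=
  exists r, 0 < r /\ forall z, Cmod z < r -> u z = v z.

Definition germ_id (u : C -> C) : Prop := germ_eq u (fun z => z).

Definition germ_inv (f fi : C -> C) : Prop :=
  holo_near0 fi /\ fi 0%C = 0%C /\
  germ_id (fun z => fi (f z)) /\ germ_id (fun z => f (fi z)).

Definition isDiff (f : C -> C) : Prop :=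
  holo_near0 f /\ f 0%C = 0%C /\ exists fi, germ_inv f fi.

Fixpoint iter (n : nat) (f : C -> C) : C -> C :=
  match n with O => fun z => z | S m => fun z => f (iter m f z) end.

Definition has_period (f : C -> C) (k : nat) : Prop :=
  (0 < k)%nat /\ germ_id (iter k f) /\
  forall j, (0 < j)%nat -> (j < k)%nat -> ~ germ_id (iter j f).

(* ||u||_r < eps, where ||u||_r = sup_{B(r)} |u| if u extends holomorphically
   to B(r) and +oo otherwise (the extension is unique by the identity theorem). *)
Definition norm_lt (r eps : R) (u : C -> C) : Prop :=
  exists phi, holo_on (disc r) phi /\ germ_eq phi u /\
    exists e, e < eps /\ forall z, disc r z -> Cmod (phi z) <= e.

Definition basic (f : C -> C) (r eps : R) (g : C -> C) : Prop :=
  norm_lt r eps (fun z => (g z - f z)%C).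

(* Open sets of Diff(C,0) in the analytic topology: unions of basic sets.
   Sets are predicates on representatives; only members satisfying isDiff count. *)
Definition an_open (U : (C -> C) -> Prop) : Prop :=
  forall h, isDiff h -> U h ->
    exists f r eps, isDiff f /\ 0 < r /\ 0 < eps /\ basic f r eps h /\
      forall g, isDiff g -> basic f r eps g -> U g.

Definition an_dense (U : (C -> C) -> Prop) : Prop :=
  forall V, an_open V -> (exists h, isDiff h /\ V h) ->
    exists h, isDiff h /\ V h /\ U h.

(* Words in the free group on a, b: a letter is (is_a, positive_exponent). *)
Definition letter := (bool * bool)%type.
Definition word := list letter.
Definition linv (x : letter) : letter := (fst x, negb (snd x)).

Inductive pres_eq (k l : nat) : word -> word -> Prop :=
| pres_refl w : pres_eq k l w w
| pres_sym u v : pres_eq k l u v -> pres_eq k l v u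
| pres_trans u v w : pres_eq k l u v -> pres_eq k l v w -> pres_eq k l u w
| pres_cancel u v x : pres_eq k l (u ++ x :: linv x :: v) (u ++ v)
| pres_rel_a u v : pres_eq k l (u ++ repeat (true, true) k ++ v) (u ++ v)
| pres_rel_b u v : pres_eq k l (u ++ repeat (false, true) l ++ v) (u ++ v).

Fixpoint eval_word (A Ai B Bi : C -> C) (w : word) : C -> C :=
  match w with
  | nil => fun z => z
  | x :: w' =>
      let L := match x with
               | (true, true) => A | (true, false) => Ai
               | (false, true) => B | (false, false) => Bi end in
      fun z => L (eval_word A Ai B Bi w' z)
  end.

(* Main.v *)
(** If [w] is not trivial in [Z/k * Z/l], the set of [h] for which [w] does not
    evaluate to the identity germ is open and dense; intersecting over the
    countably many such [w] gives the [G_delta] set.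

    Both halves rest on control that is uniform over small holomorphic
    perturbations [H] of a given [h]: by Cauchy's estimates all these [H] are
    bi-Lipschitz, hence invertible, on one fixed disc, so a reduced word is a
    holomorphic map on a fixed smaller disc, depending continuously on [H].
    By the identity theorem the word is the identity germ only if it fixes
    every point [z0] of that disc, and moving a fixed [z0] is an open condition.

    For density, the orbit of [z0 <> 0] under the successive syllables is made
    simple by perturbing [H] one [b]-syllable at a time: adding to [H] a small
    multiple of a polynomial vanishing at [0] and at the earlier orbit points
    changes only the next point, which can thus avoid any finite set.  The
    remaining collisions are excluded because a nontrivial power of a periodic
    germ has no fixed point other than [0] near [0].

    Cauchy's formula is proved from complex differentiability alone, by
    Goursat's bisection argument applied to parametrized squares. *)

Require Import Defs.
From Stdlib Require Import Reals List Lra Lia Psatz Classical ClassicalEpsilon.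
From Coquelicot Require Import Coquelicot.
Open Scope R_scope.
Import ListNotations.

(** * Differentiation in one complex or real variable *)

(** The analytic topology shapes the construction: a neighbourhood of [h] may prescribe a radius far
    beyond the disc where [h] is holomorphic, and only functions holomorphic and small on that whole
    disc may then be added to [h]. Polynomials are admissible for every radius, so all perturbations
    in the density argument are entire.

    Germs carry no uniform constants: the inverse [hi] of a perturbed map may be controlled only on
    an uncontrollably small disc. Words are therefore evaluated with a second inverse [K], built by
    a contraction on a disc of fixed radius; it agrees with [hi] as a germ.

    Syllables in [a] cannot be perturbed, since [f] is given. Their images are kept off the orbit by
    excluding, for the [b]-syllable applied just before, also the preimages of the forbidden points.

    Periodicity serves three purposes: inverse letters become positive powers, [iter (k - n) f]
    inverts [iter n f] on a fixed disc, and a nontrivial power has an isolated fixed point at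
    [0]. *)

(* Differentiation along a map [i : X -> C]: [i] is the identity for complex
   derivatives and [RtoC] for derivatives of curves. *)
Definition cont_at {X : Type} (i F : X -> C) (x : X) : Prop :=
  forall eps, 0 < eps -> exists d, 0 < d /\
    forall y, Cmod (i y - i x) < d -> Cmod (F y - F x) < eps.

Definition deriv_at {X : Type} (i F : X -> C) (x : X) (l : C) : Prop :=
  forall eps, 0 < eps -> exists d, 0 < d /\
    forall y, Cmod (i y - i x) < d ->
      Cmod (F y - F x - l * (i y - i x)) <= eps * Cmod (i y - i x).

Definition idC (z : C) : C := z.

Lemma Cmod_sub_sym (x y : C) : Cmod (x - y) = Cmod (y - x).
Proof. rewrite <- Cmod_opp. f_equal. ring. Qed.

Lemma Cmod_sub_triangle (x y z : C) : Cmod (x - z) <= Cmod (x - y) + Cmod (y - z).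
Proof.
  replace (x - z)%C with ((x - y) + (y - z))%C by ring. apply Cmod_triangle.
Qed.

Lemma Cmod_le_sub (x y : C) : Cmod x <= Cmod y + Cmod (x - y).
Proof.
  replace x with (y + (x - y))%C at 1 by ring. apply Cmod_triangle.
Qed.

Lemma Cmod_sub_le (x y : C) : Cmod (x - y) <= Cmod x + Cmod y.
Proof. rewrite <- (Cmod_opp y). apply Cmod_triangle. Qed.

Lemma Cmod_sub_eq0 (x y : C) : Cmod (x - y) <= 0 -> x = y.
Proof.
  intros H. assert (E : (x - y)%C = 0%C).
  { apply Cmod_eq_0. pose proof (Cmod_ge_0 (x - y)). lra. }
  replace x with (x - y + y)%C by ring. rewrite E. ring.
Qed.

Lemma Cmod_small_eq0 (x : C) : (forall e, 0 < e -> Cmod x <= e) -> x = 0%C.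
Proof.
  intros H. apply Cmod_eq_0. destruct (Req_dec (Cmod x) 0) as [E|E]; auto.
  pose proof (Cmod_ge_0 x). specialize (H (Cmod x / 2)). lra.
Qed.

Lemma is_derive_deriv_at (F : C -> C) (z l : C) :
  @is_derive C_AbsRing C_NormedModule F z l <-> deriv_at idC F z l.
Proof.
  unfold deriv_at, idC. split.
  - intros [_ H] eps He.
    destruct (H z (fun P HP => HP) (mkposreal _ He)) as [d Hd]. simpl in Hd.
    exists d; split; [apply cond_pos|]. intros y Hy.
    specialize (Hd y Hy). unfold norm, minus, plus, opp, scal, mult in Hd. simpl in Hd.
    unfold mult in Hd; simpl in Hd.
    replace (F y - F z - l * (y - z))%C with (F y + - F z + - ((y + - z) * l))%C by ring.
    exact Hd.
  - intros H. split.
    + apply is_linear_scal_l.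
    + intros x Hx.
      assert (E : z = x).
      { apply (@is_filter_lim_locally_unique C_AbsRing (AbsRing_NormedModule C_AbsRing) z x). exact Hx. }
      subst x. intros eps. destruct (H eps (cond_pos eps)) as [d [Hd Hd']].
      exists (mkposreal d Hd). intros y Hy. specialize (Hd' y Hy).
      unfold norm, minus, plus, opp, scal, mult; simpl. unfold mult; simpl.
      replace (F y + - F z + - ((y + - z) * l))%C with (F y - F z - l * (y - z))%C by ring.
      exact Hd'.
Qed.

Lemma cont_at_const {X} (i : X -> C) (c : C) x : cont_at i (fun _ => c) x.
Proof.
  intros e He. exists 1; split; [lra|]. intros y _.
  replace (c - c)%C with (RtoC 0) by ring. rewrite Cmod_0. exact He.
Qed.

Lemma cont_at_param {X} (i : X -> C) x : cont_at i i x.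
Proof. intros e He. exists e; auto. Qed.

Lemma cont_at_plus {X} (i F G : X -> C) x :
  cont_at i F x -> cont_at i G x -> cont_at i (fun y => F y + G y)%C x.
Proof.
  intros HF HG e He.
  destruct (HF (e / 2)) as [d1 [H1 H1']]; [lra|].
  destruct (HG (e / 2)) as [d2 [H2 H2']]; [lra|].
  exists (Rmin d1 d2); split; [apply Rmin_pos; auto|]. intros y Hy.
  specialize (H1' y (Rlt_le_trans _ _ _ Hy (Rmin_l _ _))).
  specialize (H2' y (Rlt_le_trans _ _ _ Hy (Rmin_r _ _))).
  replace (F y + G y - (F x + G x))%C with ((F y - F x) + (G y - G x))%C by ring.
  eapply Rle_lt_trans; [apply Cmod_triangle|]. lra.
Qed.

Lemma cont_at_mult {X} (i F G : X -> C) x :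
  cont_at i F x -> cont_at i G x -> cont_at i (fun y => F y * G y)%C x.
Proof.
  intros HF HG e He.
  set (M := 1 + Cmod (F x) + Cmod (G x)).
  pose proof (Cmod_ge_0 (F x)). pose proof (Cmod_ge_0 (G x)).
  assert (HM : 0 < M) by (unfold M; lra).
  assert (Hq : 0 < e / (3 * M)) by (apply Rdiv_lt_0_compat; lra).
  (* With both increments below [q <= 1], the three error terms add up to at most
     [q * M <= e / 3]. *)
  set (q := Rmin 1 (e / (3 * M))).
  assert (q0 : 0 < q) by (apply Rmin_pos; lra).
  destruct (HF q q0) as [d1 [H1 H1']].
  destruct (HG q q0) as [d2 [H2 H2']].
  exists (Rmin d1 d2); split; [apply Rmin_pos; auto|]. intros y Hy.
  specialize (H1' y (Rlt_le_trans _ _ _ Hy (Rmin_l _ _))).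
  specialize (H2' y (Rlt_le_trans _ _ _ Hy (Rmin_r _ _))).
  replace (F y * G y - F x * G x)%C
    with ((F y - F x) * (G y - G x) + (F x * (G y - G x) + (F y - F x) * G x))%C by ring.
  eapply Rle_lt_trans; [apply Cmod_triangle|].
  pose proof (Cmod_triangle (F x * (G y - G x)) ((F y - F x) * G x)) as T.
  rewrite !Cmod_mult in *.
  assert (q1 : q <= 1) by apply Rmin_l.
  assert (q2 : q * M <= e / 3).
  { apply Rle_trans with (e / (3 * M) * M); [apply Rmult_le_compat_r; [lra|apply Rmin_r]|].
    right; field; lra. }
  pose proof (Cmod_ge_0 (F y - F x)). pose proof (Cmod_ge_0 (G y - G x)).
  unfold M in q2. nra.
Qed.

Lemma cont_at_inv {X} (i F : X -> C) x :
  F x <> 0%C -> cont_at i F x -> cont_at i (fun y => / F y)%C x.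
Proof.
  intros H0 HF e He.
  assert (Hm : 0 < Cmod (F x)) by (apply Cmod_gt_0; auto).
  set (m := Cmod (F x)) in *.
  assert (Hq : 0 < e * m * m / 2) by (apply Rdiv_lt_0_compat; [|lra]; repeat apply Rmult_lt_0_compat; auto).
  destruct (HF (Rmin (m / 2) (e * m * m / 2))) as [d [Hd Hd']]; [apply Rmin_pos; lra|].
  exists d; split; auto. intros y Hy. specialize (Hd' y Hy).
  assert (A1 := Rlt_le_trans _ _ _ Hd' (Rmin_l _ _)).
  assert (A2 := Rlt_le_trans _ _ _ Hd' (Rmin_r _ _)).
  assert (Hy' : m / 2 < Cmod (F y)).
  { pose proof (Cmod_le_sub (F x) (F y)). rewrite Cmod_sub_sym in H. fold m in H. lra. }
  assert (Hn : F y <> 0%C) by (apply Cmod_gt_0; lra).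
  replace (/ F y - / F x)%C with ((F x - F y) / (F y * F x))%C by (field; auto).
  rewrite Cmod_div by (apply Cmult_neq_0; auto). rewrite Cmod_mult, Cmod_sub_sym. fold m.
  apply Rmult_lt_reg_r with (Cmod (F y) * m); [apply Rmult_lt_0_compat; lra|].
  unfold Rdiv. rewrite Rmult_assoc, Rinv_l by (apply Rmult_integral_contrapositive; split; lra).
  rewrite Rmult_1_r. apply Rlt_le_trans with (1 := A2).
  assert (e * m * (m / 2) <= e * m * Cmod (F y)) by (apply Rmult_le_compat_l; [nra|lra]).
  nra.
Qed.

Lemma cont_at_comp {X} (i g : X -> C) (F : C -> C) x :
  cont_at idC F (g x) -> cont_at i g x -> cont_at i (fun y => F (g y)) x.
Proof.
  intros HF Hg e He. destruct (HF e He) as [d [Hd Hd']].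
  destruct (Hg d Hd) as [d2 [H2 H2']]. exists d2; split; auto.
  intros y Hy. apply Hd', H2', Hy.
Qed.

Lemma cont_at_ext {X} (i F G : X -> C) x :
  (forall y, F y = G y) -> cont_at i F x -> cont_at i G x.
Proof.
  intros E H e He. destruct (H e He) as [d [Hd Hd']]. exists d; split; auto.
  intros y Hy. rewrite <- !E. auto.
Qed.

(* Caratheodory's form of differentiability, from which the differentiation rules follow algebraically. *)
Lemma deriv_at_slope {X} (i F : X -> C) x l :
  deriv_at i F x l <->
  exists s, cont_at i s x /\ s x = l /\ forall y, (F y = F x + s y * (i y - i x))%C.
Proof.
  split.
  - intros H.
    exists (fun y => if excluded_middle_informative (i y = i x) then l
                     else ((F y - F x) / (i y - i x))%C).
    split; [|split].
    + intros e He. destruct (H (e / 2)) as [d [Hd Hd']]; [lra|].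
      exists d; split; auto. intros y Hy. specialize (Hd' y Hy).
      destruct (excluded_middle_informative (i x = i x)) as [_|n]; [|congruence].
      destruct (excluded_middle_informative (i y = i x)) as [E|n].
      * replace (l - l)%C with (RtoC 0) by ring. rewrite Cmod_0; auto.
      * assert (Hn : (i y - i x)%C <> 0%C).
        { intros E. apply n. replace (i y) with (i y - i x + i x)%C by ring. rewrite E. ring. }
        replace ((F y - F x) / (i y - i x) - l)%C
          with ((F y - F x - l * (i y - i x)) / (i y - i x))%C by (field; auto).
        rewrite Cmod_div by auto.
        assert (Hp : 0 < Cmod (i y - i x)) by (apply Cmod_gt_0; auto).
        apply Rle_lt_trans with (e / 2); [|lra].
        apply Rmult_le_reg_r with (Cmod (i y - i x)); auto.
        unfold Rdiv at 1. rewrite Rmult_assoc, Rinv_l by lra. lra.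
    + destruct (excluded_middle_informative (i x = i x)); congruence.
    (* Two parameters may share the same value of [i]; the differentiability estimate then reads
       [Cmod (F y - F x) <= 0]. *)
    + intros y. destruct (excluded_middle_informative (i y = i x)) as [E|n].
      * rewrite E. replace (l * (i x - i x))%C with (RtoC 0) by ring. rewrite Cplus_0_r.
        destruct (H 1 Rlt_0_1) as [d [Hd Hd']]. specialize (Hd' y). rewrite E in Hd'.
        replace (i x - i x)%C with (RtoC 0) in Hd' by ring. rewrite Cmod_0 in Hd'.
        apply Cmod_sub_eq0.
        replace (F y - F x)%C with (F y - F x - l * 0)%C by ring. specialize (Hd' Hd). lra.
      * field. intros E. apply n. replace (i y) with (i y - i x + i x)%C by ring. rewrite E. ring.
  - intros [s [Hs [E1 E2]]] e He. destruct (Hs e He) as [d [Hd Hd']].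
    exists d; split; auto. intros y Hy. rewrite (E2 y).
    replace (F x + s y * (i y - i x) - F x - l * (i y - i x))%C
      with ((s y - s x) * (i y - i x))%C by (rewrite E1; ring).
    rewrite Cmod_mult. apply Rmult_le_compat_r; [apply Cmod_ge_0|]. left; auto.
Qed.

Lemma deriv_at_cont {X} (i F : X -> C) x l : deriv_at i F x l -> cont_at i F x.
Proof.
  intros H. apply deriv_at_slope in H. destruct H as [s [Hs [_ E]]].
  apply cont_at_ext with (fun y => F x + s y * (i y + - i x))%C.
  - intros y. rewrite (E y). ring.
  - apply cont_at_plus; [apply cont_at_const|]. apply cont_at_mult; auto.
    apply cont_at_plus; [apply cont_at_param|apply cont_at_const].
Qed.

Lemma deriv_at_const {X} (i : X -> C) (c : C) x : deriv_at i (fun _ => c) x 0%C.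
Proof.
  apply deriv_at_slope. exists (fun _ => 0%C). repeat split; [apply cont_at_const|].
  intros; ring.
Qed.

Lemma deriv_at_param {X} (i : X -> C) x : deriv_at i i x 1%C.
Proof.
  apply deriv_at_slope. exists (fun _ => 1%C). repeat split; [apply cont_at_const|].
  intros; ring.
Qed.

Lemma deriv_at_ext {X} (i F G : X -> C) x l l' :
  (forall y, F y = G y) -> l = l' -> deriv_at i F x l -> deriv_at i G x l'.
Proof.
  intros E <- H e He. destruct (H e He) as [d [Hd Hd']]. exists d; split; auto.
  intros y Hy. rewrite <- !E. auto.
Qed.

Lemma deriv_at_plus {X} (i F G : X -> C) x a b :
  deriv_at i F x a -> deriv_at i G x b -> deriv_at i (fun y => F y + G y)%C x (a + b)%C.
Proof.
  rewrite !deriv_at_slope. intros [s [H1 [E1 K1]]] [t [H2 [E2 K2]]].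
  exists (fun y => s y + t y)%C. split; [apply cont_at_plus; auto|].
  rewrite E1, E2. split; auto. intros y. rewrite (K1 y), (K2 y). ring.
Qed.

Lemma deriv_at_mult {X} (i F G : X -> C) x a b :
  deriv_at i F x a -> deriv_at i G x b ->
  deriv_at i (fun y => F y * G y)%C x (a * G x + F x * b)%C.
Proof.
  intros HF HG. pose proof (deriv_at_cont _ _ _ _ HG) as HG'. revert HF HG.
  rewrite !deriv_at_slope. intros [s [H1 [E1 K1]]] [t [H2 [E2 K2]]].
  exists (fun y => s y * G y + F x * t y)%C. split.
  - apply cont_at_plus; apply cont_at_mult; auto using cont_at_const.
  - rewrite E1, E2. split; auto. intros y. rewrite (K1 y), (K2 y). ring.
Qed.

(** Local variant of the slope criterion, for reciprocals and inverse maps, whose slope identity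
    holds only near [x]. *)
Lemma deriv_at_of_slope {X} (i F s : X -> C) x l r :
  0 < r -> cont_at i s x -> s x = l ->
  (forall y, Cmod (i y - i x) < r -> F y = (F x + s y * (i y - i x))%C) -> deriv_at i F x l.
Proof.
  intros Hr Hs E1 E2 e He. destruct (Hs e He) as [d [Hd Hd']].
  exists (Rmin d r); split; [apply Rmin_pos; auto|]. intros y Hy.
  pose proof (Rmin_l d r). pose proof (Rmin_r d r).
  rewrite (E2 y) by lra.
  replace (F x + s y * (i y - i x) - F x - l * (i y - i x))%C
    with ((s y - s x) * (i y - i x))%C by (rewrite E1; ring).
  rewrite Cmod_mult. apply Rmult_le_compat_r; [apply Cmod_ge_0|]. left; apply Hd'; lra.
Qed.

Lemma deriv_at_inv {X} (i F : X -> C) x a :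
  F x <> 0%C -> deriv_at i F x a -> deriv_at i (fun y => / F y)%C x (- a / (F x * F x))%C.
Proof.
  intros H0 HF. pose proof (deriv_at_cont _ _ _ _ HF) as HF'.
  destruct (HF' (Cmod (F x))) as [r [Hr Hr']]; [apply Cmod_gt_0; auto|].
  apply deriv_at_slope in HF. destruct HF as [s [H1 [E1 K1]]].
  apply deriv_at_of_slope with (r := r) (s := fun y => ((- (1)) * s y * / F y * / F x)%C); auto.
  - repeat apply cont_at_mult; auto using cont_at_const.
    apply cont_at_inv; auto.
  - rewrite E1. field; auto.
  - intros y Hy. specialize (Hr' y Hy).
    assert (Hn : F y <> 0%C).
    { intros E. rewrite E in Hr'. replace (0 - F x)%C with (- F x)%C in Hr' by ring.
      rewrite Cmod_opp in Hr'. lra. }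
    replace (/ F y)%C with (/ F x + (F x - F y) * / F y * / F x)%C at 1 by (field; auto).
    rewrite (K1 y) at 1. ring.
Qed.

Lemma deriv_at_comp {X} (i g : X -> C) (F : C -> C) x a b :
  deriv_at idC F (g x) a -> deriv_at i g x b -> deriv_at i (fun y => F (g y)) x (a * b)%C.
Proof.
  intros HF Hg. pose proof (deriv_at_cont _ _ _ _ Hg) as Hg'. revert HF Hg.
  rewrite !deriv_at_slope. intros [s [H1 [E1 K1]]] [t [H2 [E2 K2]]].
  exists (fun y => s (g y) * t y)%C. split.
  - apply cont_at_mult; auto. apply cont_at_comp; auto.
  - rewrite E1, E2. split; auto. intros y. unfold idC in K1. rewrite (K1 (g y)), (K2 y). ring.
Qed.

Lemma deriv_at_unique (F : C -> C) x a b : deriv_at idC F x a -> deriv_at idC F x b -> a = b.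
Proof.
  intros Ha Hb. apply is_derive_deriv_at in Ha. apply is_derive_deriv_at in Hb.
  rewrite <- (is_C_derive_unique _ _ _ Ha). apply is_C_derive_unique. exact Hb.
Qed.

Lemma deriv_at_ext_loc (F G : C -> C) x l r :
  0 < r -> (forall y, Cmod (y - x) < r -> F y = G y) -> deriv_at idC F x l -> deriv_at idC G x l.
Proof.
  intros Hr E H e He. destruct (H e He) as [d [Hd Hd']]. unfold idC in *.
  exists (Rmin d r); split; [apply Rmin_pos; auto|]. intros y Hy.
  pose proof (Rmin_l d r). pose proof (Rmin_r d r).
  rewrite <- !E by (try lra; replace (x - x)%C with (RtoC 0) by ring; rewrite Cmod_0; auto).
  apply Hd'. lra.
Qed.

(** * Goursat's theorem *)

Lemma nested_segments (x s : nat -> R) :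
  (forall n, x n <= x (S n)) -> (forall n, x (S n) + s (S n) <= x n + s n) ->
  (forall n, 0 <= s n) -> exists p, forall n, x n <= p <= x n + s n.
Proof.
  intros Hx Hs H0.
  assert (Hxm : forall n k, x n <= x (k + n)%nat).
  { intros n k; induction k; simpl; [lra|]. specialize (Hx (k + n)%nat). lra. }
  assert (Hsm : forall n k, x (k + n)%nat + s (k + n)%nat <= x n + s n).
  { intros n k; induction k; simpl; [lra|]. specialize (Hs (k + n)%nat). lra. }
  assert (Hb : forall n k, x k <= x n + s n).
  { intros n k. pose proof (Hxm k n) as A. pose proof (Hsm n k) as B.
    rewrite (Nat.add_comm k n) in B. specialize (H0 (n + k)%nat). lra. }
  destruct (completeness (fun r => exists n, r = x n)) as [p [Hp1 Hp2]].
  - exists (x 0%nat + s 0%nat). intros r [n ->]. apply Hb.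
  - exists (x 0%nat). eauto.
  - exists p. intros n. split; [apply Hp1; eauto|]. apply Hp2. intros r [k ->]. apply Hb.
Qed.

(** If [J 0 0 1] had modulus [m > 0], additivity would give at each stage a quarter whose modulus is
    at least [m] times its area; these squares shrink to a point where the local estimate with
    [e = m / 2] is contradicted. *)
Lemma square_bisection (J : R -> R -> R -> C) :
  (forall x y s, 0 <= x -> 0 <= y -> 0 < s -> x + s <= 1 -> y + s <= 1 ->
    J x y s = (J x y (s / 2)%R + J (x + s / 2)%R y (s / 2)%R + J x (y + s / 2)%R (s / 2)%R
               + J (x + s / 2)%R (y + s / 2)%R (s / 2)%R)%C) ->
  (forall p q, 0 <= p <= 1 -> 0 <= q <= 1 -> forall e, 0 < e -> exists d, 0 < d /\
    forall x y s, 0 <= x -> 0 <= y -> x + s <= 1 -> y + s <= 1 -> 0 < s < d ->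
      x <= p <= x + s -> y <= q <= y + s -> Cmod (J x y s) <= e * (s * s)) ->
  J 0 0 1 = 0%C.
Proof.
  intros Hadd Hloc. apply Cmod_eq_0.
  destruct (Req_dec (Cmod (J 0 0 1)) 0) as [E|E]; auto. exfalso.
  pose proof (Cmod_ge_0 (J 0 0 1)). set (m := Cmod (J 0 0 1)) in *.
  pose (P := fun t : R * R * R => let '(x, y, s) := t in
     0 <= x /\ 0 <= y /\ 0 < s /\ x + s <= 1 /\ y + s <= 1 /\ m * (s * s) <= Cmod (J x y s)).
  pose (nxt := fun t u : R * R * R => let '(x, y, s) := t in let '(x', y', s') := u in
     x <= x' /\ x' + s' <= x + s /\ y <= y' /\ y' + s' <= y + s /\ s' = s / 2).
  assert (Hstep : forall t, P t -> exists u, P u /\ nxt t u).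
  { intros [[x y] s] (H1 & H2 & H3 & H4 & H5 & H6).
    destruct (classic (exists u, P u /\ nxt (x, y, s) u)) as [K|K]; auto. exfalso.
    assert (B : forall x' y', x <= x' <= x + s / 2 -> y <= y' <= y + s / 2 ->
                  Cmod (J x' y' (s / 2)) < m * ((s / 2) * (s / 2))).
    { intros x' y' Hx Hy. apply Rnot_le_lt. intros Hc. apply K. exists (x', y', s / 2).
      simpl. repeat split; lra. }
    rewrite Hadd in H6 by assumption.
    pose proof (B x y ltac:(lra) ltac:(lra)).
    pose proof (B (x + s / 2) y ltac:(lra) ltac:(lra)).
    pose proof (B x (y + s / 2) ltac:(lra) ltac:(lra)).
    pose proof (B (x + s / 2) (y + s / 2) ltac:(lra) ltac:(lra)).
    set (a := J x y (s / 2)) in *. set (b := J (x + s / 2) y (s / 2)) in *.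
    set (c := J x (y + s / 2) (s / 2)) in *. set (d := J (x + s / 2) (y + s / 2) (s / 2)) in *.
    pose proof (Cmod_triangle (a + b + c) d). pose proof (Cmod_triangle (a + b) c).
    pose proof (Cmod_triangle a b). lra. }
  assert (P0 : P (0, 0, 1)) by (simpl; unfold m; repeat split; lra).
  pose (next := fun t : {t | P t} =>
     let w := constructive_indefinite_description _ (Hstep (proj1_sig t) (proj2_sig t)) in
     exist P (proj1_sig w) (proj1 (proj2_sig w))).
  pose (seq := fix seq n := match n with O => exist P (0, 0, 1) P0 | S k => next (seq k) end).
  assert (Hn : forall n, nxt (proj1_sig (seq n)) (proj1_sig (seq (S n)))).
  { intros n. simpl. destruct (constructive_indefinite_description _ _) as [u [Hu1 Hu2]]. exact Hu2. }
  pose (X := fun n => fst (fst (proj1_sig (seq n)))).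
  pose (Y := fun n => snd (fst (proj1_sig (seq n)))).
  pose (S' := fun n => snd (proj1_sig (seq n))).
  assert (HP : forall n, P (X n, Y n, S' n)).
  { intros n. unfold X, Y, S'. destruct (seq n) as [[[x y] s] Hp]. exact Hp. }
  assert (HN : forall n, nxt (X n, Y n, S' n) (X (S n), Y (S n), S' (S n))).
  { intros n. specialize (Hn n). unfold X, Y, S'.
    destruct (seq n) as [[[x y] s] Hp]. destruct (seq (S n)) as [[[x' y'] s'] Hp']. exact Hn. }
  simpl in HP, HN.
  destruct (nested_segments X S') as [p Hp].
  1-3: intros n; specialize (HN n); specialize (HP n); lra.
  destruct (nested_segments Y S') as [q Hq].
  1-3: intros n; specialize (HN n); specialize (HP n); lra.
  assert (HS : forall n, S' n = / 2 ^ n).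
  { induction n; [unfold S'; simpl; lra|]. destruct (HN n) as (_ & _ & _ & _ & ->).
    rewrite IHn. simpl. field. apply pow_nonzero; lra. }
  destruct (Hloc p q) with (e := m / 2) as [d [Hd Hd']].
  - specialize (HP 0%nat). specialize (Hp 0%nat). lra.
  - specialize (HP 0%nat). specialize (Hq 0%nat). lra.
  - lra.
  - destruct (pow_lt_1_zero (/ 2)) with (y := d) as [N HN']; auto.
    { rewrite Rabs_right; lra. }
    specialize (HN' N (le_n N)). rewrite pow_inv, <- HS in HN'.
    specialize (HP N). rewrite Rabs_right in HN' by lra.
    specialize (Hd' (X N) (Y N) (S' N)). specialize (Hp N). specialize (Hq N).
    assert (0 < S' N * S' N) by (apply Rmult_lt_0_compat; lra).
    assert (Cmod (J (X N) (Y N) (S' N)) <= m / 2 * (S' N * S' N)) by (apply Hd'; lra).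
    nra.
Qed.

(** * Integrals of complex-valued functions of a real variable *)

Definition cint (f : R -> C) (a b : R) : C := @RInt C_R_CompleteNormedModule f a b.

Definition cint_ex (f : R -> C) (a b : R) : Prop := @ex_RInt C_R_CompleteNormedModule f a b.

Lemma Cmod_RtoC_sub (x y : R) : Cmod (RtoC x - RtoC y) = Rabs (x - y).
Proof. rewrite <- RtoC_minus. apply Cmod_R. Qed.

Lemma Cmod_fst (z : C) : Rabs (fst z) <= Cmod z.
Proof. eapply Rle_trans; [apply Rmax_l|apply Rmax_Cmod]. Qed.

Lemma Cmod_snd (z : C) : Rabs (snd z) <= Cmod z.
Proof. eapply Rle_trans; [apply Rmax_r|apply Rmax_Cmod]. Qed.

Lemma cont_at_continuous (f : R -> C) t :
  cont_at RtoC f t -> @continuous R_UniformSpace C_R_CompleteNormedModule f t.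
Proof.
  intros H P [eps HP]. destruct (H eps (cond_pos eps)) as [d [Hd Hd']].
  exists (mkposreal d Hd). intros y Hy. apply HP.
  specialize (Hd' y). rewrite Cmod_RtoC_sub in Hd'. specialize (Hd' Hy).
  split; (eapply Rle_lt_trans; [|exact Hd']).
  - exact (Cmod_fst (f y - f t)).
  - exact (Cmod_snd (f y - f t)).
Qed.

Lemma cint_ex_cont (f : R -> C) a b :
  a <= b -> (forall t, a <= t <= b -> cont_at RtoC f t) -> cint_ex f a b.
Proof.
  intros Hab H. apply (@ex_RInt_continuous C_R_CompleteNormedModule).
  intros z. rewrite Rmin_left, Rmax_right by auto. intros Hz. apply cont_at_continuous; auto.
Qed.

Lemma cint_chasles (f : R -> C) a b c :
  cint_ex f a b -> cint_ex f b c -> (cint f a b + cint f b c)%C = cint f a c.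
Proof. intros H1 H2. exact (@RInt_Chasles C_R_CompleteNormedModule f a b c H1 H2). Qed.

Lemma cint_plus (f g : R -> C) a b :
  cint_ex f a b -> cint_ex g a b ->
  cint (fun t => f t + g t)%C a b = (cint f a b + cint g a b)%C.
Proof. intros H1 H2. exact (@RInt_plus C_R_CompleteNormedModule f g a b H1 H2). Qed.

Lemma cint_minus (f g : R -> C) a b :
  cint_ex f a b -> cint_ex g a b ->
  cint (fun t => f t - g t)%C a b = (cint f a b - cint g a b)%C.
Proof. intros H1 H2. exact (@RInt_minus C_R_CompleteNormedModule f g a b H1 H2). Qed.

Lemma cint_ext (f g : R -> C) a b :
  a <= b -> (forall t, a < t < b -> f t = g t) -> cint f a b = cint g a b.
Proof.
  intros Hab H. apply (@RInt_ext C_R_CompleteNormedModule). intros x. rewrite Rmin_left, Rmax_right by auto. apply H.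
Qed.

(** The module structure under the integral is real, so multiplication by a complex [c] is checked
    on the two coordinates. *)
Lemma cint_scal (c : C) (f : R -> C) a b :
  cint_ex f a b -> cint (fun t => c * f t)%C a b = (c * cint f a b)%C.
Proof.
  intros H. apply (@RInt_correct C_R_CompleteNormedModule) in H.
  unfold cint. set (I := @RInt C_R_CompleteNormedModule f a b) in *.
  apply (@is_RInt_unique C_R_CompleteNormedModule).
  pose proof (is_RInt_fct_extend_fst _ _ _ _ H) as H1.
  pose proof (is_RInt_fct_extend_snd _ _ _ _ H) as H2.
  apply (is_RInt_fct_extend_pair (U := R_NormedModule) (V := R_NormedModule)).
  - apply (is_RInt_minus (V := R_NormedModule)); apply (is_RInt_scal (V := R_NormedModule)); assumption.
  - apply (is_RInt_plus (V := R_NormedModule)); apply (is_RInt_scal (V := R_NormedModule)); assumption.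
Qed.

Lemma cint_bound (f : R -> C) a b M :
  a <= b -> cint_ex f a b -> (forall t, a <= t <= b -> Cmod (f t) <= M) ->
  Cmod (cint f a b) <= (b - a) * M.
Proof.
  intros Hab H HM. rewrite Cmod_norm.
  refine (norm_RInt_le_const (V := C_R_NormedModule) f a b (cint f a b) M Hab _ _).
  - intros t Ht. specialize (HM t Ht). rewrite Cmod_norm in HM. exact HM.
  - exact (@RInt_correct C_R_CompleteNormedModule f a b H).
Qed.

Lemma deriv_at_is_derive_R (F : R -> C) t (l : C) :
  deriv_at RtoC F t l -> @is_derive R_AbsRing C_R_NormedModule F t l.
Proof.
  intros H. split; [apply is_linear_scal_l|].
  intros x Hx.
  assert (E : (t : R_NormedModule) = x) by (apply is_filter_lim_locally_unique; exact Hx).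
  rewrite <- E. intros eps. destruct (H eps (cond_pos eps)) as [d [Hd Hd']].
  exists (mkposreal d Hd). intros y Hy.
  specialize (Hd' y). rewrite Cmod_RtoC_sub in Hd'. specialize (Hd' Hy).
  change (norm (minus y t)) with (Rabs (y - t)).
  eapply Rle_trans; [|exact Hd']. right. rewrite Cmod_norm.
  match goal with |- @norm _ _ ?u = norm ?v => replace u with v; [reflexivity|] end.
  apply injective_projections; simpl; unfold scal, plus, opp, minus; simpl; unfold mult; simpl;
    change (plus y (opp t)) with (y + - t); ring.
Qed.

Lemma cint_deriv (F f : R -> C) a b :
  a <= b -> (forall t, a <= t <= b -> deriv_at RtoC F t (f t)) ->
  (forall t, a <= t <= b -> cont_at RtoC f t) -> cint f a b = (F b - F a)%C.
Proof.
  intros Hab H1 H2.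
  apply (@is_RInt_unique C_R_CompleteNormedModule).
  apply (@is_RInt_derive C_R_CompleteNormedModule F f a b);
    intros t; rewrite Rmin_left, Rmax_right by auto; intros Ht.
  - apply deriv_at_is_derive_R; auto.
  - apply cont_at_continuous; auto.
Qed.

Lemma deriv_bound_lipschitz (F f : R -> C) a b M :
  a <= b -> (forall t, a <= t <= b -> deriv_at RtoC F t (f t)) ->
  (forall t, a <= t <= b -> cont_at RtoC f t) -> (forall t, a <= t <= b -> Cmod (f t) <= M) ->
  Cmod (F b - F a) <= (b - a) * M.
Proof.
  intros Hab H1 H2 H3. rewrite <- (cint_deriv F f a b) by auto.
  apply cint_bound; auto. apply cint_ex_cont; auto.
Qed.

Definition affine_primitive (z c l w : C) : C := (c * w + l * ((w - z) * (w - z)) * / 2)%C.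

Lemma deriv_affine_primitive (z c l w : C) :
  deriv_at idC (affine_primitive z c l) w (c + l * (w - z))%C.
Proof.
  assert (Hw : deriv_at idC (fun w => idC w + - z)%C w (1 + 0)%C)
    by (apply deriv_at_plus; [apply deriv_at_param|apply deriv_at_const]).
  assert (H2 : (2 : C) <> 0%C) by (intros E; apply RtoC_inj in E; lra).
  eapply deriv_at_ext;
    [| |apply deriv_at_plus;
        [apply (deriv_at_mult idC (fun _ => c) idC); [apply deriv_at_const|apply deriv_at_param]
        |apply (deriv_at_mult idC (fun w => l * ((idC w + - z) * (idC w + - z)))%C (fun _ => / 2)%C);
          [apply deriv_at_mult; [apply deriv_at_const|apply deriv_at_mult; exact Hw]
          |apply deriv_at_const]]].
  - intros y. unfold affine_primitive, idC. field; auto.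
  - unfold idC. field; auto.
Qed.

(** Along the edge, [G] is replaced by its tangent map at [z], which has the primitive
    [affine_primitive]. The endpoint values of that primitive telescope around a square, so only the
    error term survives. *)
Lemma edge_integral (G : C -> C) (g dg : R -> C) a b z l B M :
  a <= b -> 0 <= B ->
  (forall t, a <= t <= b -> deriv_at RtoC g t (dg t)) ->
  (forall t, a <= t <= b -> cont_at RtoC dg t) ->
  (forall t, a <= t <= b -> Cmod (dg t) <= M) ->
  (forall t, a <= t <= b -> cont_at idC G (g t)) ->
  (forall t, a <= t <= b -> Cmod (G (g t) - G z - l * (g t - z)) <= B) ->
  Cmod (cint (fun t => G (g t) * dg t)%C a b
        - (affine_primitive z (G z) l (g b) - affine_primitive z (G z) l (g a)))
  <= (b - a) * (B * M).
Proof.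
  intros Hab HB0 Hg Hdg HM HG HB.
  assert (Hgc : forall t, a <= t <= b -> cont_at RtoC g t)
    by (intros t Ht; eapply deriv_at_cont; apply Hg; auto).
  assert (Hd : forall t, a <= t <= b -> cont_at RtoC (fun t => (G z + l * (g t + - z)) * dg t)%C t).
  { intros t Ht. apply cont_at_mult; auto. apply cont_at_plus; [apply cont_at_const|].
    apply cont_at_mult; [apply cont_at_const|]. apply cont_at_plus; auto using cont_at_const. }
  assert (HGg : forall t, a <= t <= b -> cont_at RtoC (fun t => G (g t) * dg t)%C t).
  { intros t Ht. apply cont_at_mult; auto. apply cont_at_comp; auto. }
  rewrite <- (cint_deriv (fun t => affine_primitive z (G z) l (g t))
                (fun t => (G z + l * (g t + - z)) * dg t)%C a b); auto.
  2:{ intros t Ht. apply deriv_at_comp; auto. apply deriv_affine_primitive. }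
  rewrite <- cint_minus by (apply cint_ex_cont; auto).
  apply cint_bound; auto.
  - apply cint_ex_cont; auto. intros t Ht.
    apply cont_at_ext with (fun t => G (g t) * dg t + (- (1)) * ((G z + l * (g t + - z)) * dg t))%C.
    + intros y; ring.
    + apply cont_at_plus; auto. apply cont_at_mult; auto using cont_at_const.
  - intros t Ht.
    replace (G (g t) * dg t - (G z + l * (g t + - z)) * dg t)%C
      with ((G (g t) - G z - l * (g t - z)) * dg t)%C by ring.
    rewrite Cmod_mult. apply Rmult_le_compat; auto using Cmod_ge_0.
Qed.

Definition in01 (t : R) : Prop := 0 <= t <= 1.

(** Derivatives are taken at all real parameters, so no one-sided derivative arises on the boundary;
    only the bound is restricted to the unit square. *)
Definition smooth_square (g g1 g2 : R -> R -> C) (M : R) : Prop :=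
  (forall u v, deriv_at RtoC (fun u => g u v) u (g1 u v)) /\
  (forall u v, deriv_at RtoC (fun v => g u v) v (g2 u v)) /\
  (forall u v, cont_at RtoC (fun u => g1 u v) u) /\
  (forall u v, cont_at RtoC (fun v => g2 u v) v) /\
  (forall u v, in01 u -> in01 v -> Cmod (g1 u v) <= M /\ Cmod (g2 u v) <= M).

Lemma smooth_square_lipschitz g g1 g2 M u v u' v' :
  smooth_square g g1 g2 M -> in01 u -> in01 v -> in01 u' -> in01 v' ->
  Cmod (g u v - g u' v') <= M * (Rabs (u - u') + Rabs (v - v')).
Proof.
  intros (H1 & H2 & H3 & H4 & H5) Hu Hv Hu' Hv'. unfold in01 in *.
  assert (A : forall a b w, 0 <= a -> b <= 1 -> a <= b -> in01 w ->
                Cmod (g b w - g a w) <= (b - a) * M).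
  { intros a b w Ha Hb Hab Hw.
    apply (deriv_bound_lipschitz (fun u => g u w) (fun u => g1 u w)); auto.
    intros t Ht. apply H5; [unfold in01; lra|auto]. }
  assert (B : forall a b w, 0 <= a -> b <= 1 -> a <= b -> in01 w ->
                Cmod (g w b - g w a) <= (b - a) * M).
  { intros a b w Ha Hb Hab Hw.
    apply (deriv_bound_lipschitz (fun v => g w v) (fun v => g2 w v)); auto.
    intros t Ht. apply H5; [auto|unfold in01; lra]. }
  assert (A' : Cmod (g u v - g u' v) <= M * Rabs (u - u')).
  { destruct (Rle_dec u u').
    - rewrite Cmod_sub_sym, Rabs_left1 by lra. specialize (A u u' v). unfold in01 in A. lra.
    - rewrite Rabs_right by lra. specialize (A u' u v). unfold in01 in A. lra. }
  assert (B' : Cmod (g u' v - g u' v') <= M * Rabs (v - v')).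
  { destruct (Rle_dec v v').
    - rewrite Cmod_sub_sym, Rabs_left1 by lra. specialize (B v v' u'). unfold in01 in B. lra.
    - rewrite Rabs_right by lra. specialize (B v' v u'). unfold in01 in B. lra. }
  pose proof (Cmod_sub_triangle (g u v) (g u' v) (g u' v')). lra.
Qed.

(** On a small subsquare the four edge integrals differ from a telescoping sum by the tangent error
    of [G], which is [o(s)] on edges of length [O(s)]. As [g] is an arbitrary smooth map of the
    square, deformations of closed curves are covered directly. *)
Lemma goursat (G : C -> C) g g1 g2 M :
  0 < M -> smooth_square g g1 g2 M ->
  (forall u v, in01 u -> in01 v -> exists l, deriv_at idC G (g u v) l) ->
  (cint (fun u => G (g u 0) * g1 u 0)%C 0 1 + cint (fun v => G (g 1 v) * g2 1 v)%C 0 1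
   = cint (fun u => G (g u 1) * g1 u 1)%C 0 1 + cint (fun v => G (g 0 v) * g2 0 v)%C 0 1)%C.
Proof.
  intros HM Hs HG. pose proof Hs as (H1 & H2 & H3 & H4 & H5).
  set (E1 := fun u v => (G (g u v) * g1 u v)%C). set (E2 := fun u v => (G (g u v) * g2 u v)%C).
  pose (J := fun x y s : R =>
     (cint (fun u => E1 u y) x (x + s) + cint (fun v => E2 (x + s)%R v) y (y + s)
      - cint (fun u => E1 u (y + s)%R) x (x + s) - cint (fun v => E2 x v) y (y + s))%C).
  assert (Gc : forall u v, in01 u -> in01 v -> cont_at idC G (g u v)).
  { intros u v Hu Hv. destruct (HG u v Hu Hv) as [l Hl]. eapply deriv_at_cont; eauto. }
  assert (X1 : forall a b w, 0 <= a -> b <= 1 -> a <= b -> in01 w -> cint_ex (fun u => E1 u w) a b).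
  { intros a b w Ha Hb Hab Hw. apply cint_ex_cont; auto. intros t Ht.
    apply cont_at_mult; auto. apply (cont_at_comp RtoC (fun u => g u w)).
    - apply Gc; [unfold in01; lra|auto].
    - eapply deriv_at_cont; apply H1. }
  assert (X2 : forall a b w, 0 <= a -> b <= 1 -> a <= b -> in01 w -> cint_ex (fun v => E2 w v) a b).
  { intros a b w Ha Hb Hab Hw. apply cint_ex_cont; auto. intros t Ht.
    apply cont_at_mult; auto. apply (cont_at_comp RtoC (fun v => g w v)).
    - apply Gc; [auto|unfold in01; lra].
    - eapply deriv_at_cont; apply H2. }
  assert (HJ : J 0 0 1 = 0%C).
  { apply square_bisection.
    - intros x y s Hx Hy Hs0 Hx1 Hy1. unfold J.
      replace (x + s / 2 + s / 2) with (x + s) by field.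
      replace (y + s / 2 + s / 2) with (y + s) by field.
      assert (C1 : forall w, in01 w ->
        cint (fun u => E1 u w) x (x + s) =
        (cint (fun u => E1 u w) x (x + s / 2)%R + cint (fun u => E1 u w) (x + s / 2)%R (x + s)%R)%C).
      { intros w Hw. symmetry. apply cint_chasles; apply X1; auto; lra. }
      assert (C2 : forall w, in01 w ->
        cint (fun v => E2 w v) y (y + s) =
        (cint (fun v => E2 w v) y (y + s / 2)%R + cint (fun v => E2 w v) (y + s / 2)%R (y + s)%R)%C).
      { intros w Hw. symmetry. apply cint_chasles; apply X2; auto; lra. }
      rewrite (C1 y), (C1 (y + s)), (C2 x), (C2 (x + s)) by (unfold in01; lra). ring.
    - intros p q Hp Hq e He. destruct (HG p q Hp Hq) as [l Hl].
      (* Points of the subsquare lie within [2 * M * s] of [z]; four edges, each of error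
         [s * B * M], then give exactly [e * (s * s)]. *)
      assert (He' : 0 < e / (8 * M * M)).
      { apply Rdiv_lt_0_compat; auto. nra. }
      destruct (Hl _ He') as [d [Hd Hd']]. unfold idC in Hd'.
      assert (Hdm : 0 < d / (2 * M)) by (apply Rdiv_lt_0_compat; lra).
      exists (d / (2 * M)); split; auto.
      intros x y s Hx Hy Hx1 Hy1 Hs1 Hpx Hqy.
      set (z := g p q) in *. set (P := affine_primitive z (G z) l).
      set (B := e / (8 * M * M) * (2 * M * s)).
      assert (HB0 : 0 <= B) by (unfold B; apply Rmult_le_pos; nra).
      assert (HB : forall u v, x <= u <= x + s -> y <= v <= y + s ->
                Cmod (G (g u v) - G z - l * (g u v - z)) <= B).
      { intros u v Hu Hv.
        assert (L : Cmod (g u v - z) <= 2 * M * s).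
        { eapply Rle_trans; [apply (smooth_square_lipschitz _ _ _ _ _ _ _ _ Hs); unfold in01; lra|].
          assert (Rabs (u - p) <= s) by (apply Rabs_le; lra).
          assert (Rabs (v - q) <= s) by (apply Rabs_le; lra). nra. }
        eapply Rle_trans; [apply Hd'|].
        - apply Rle_lt_trans with (1 := L).
          apply Rlt_le_trans with (2 * M * (d / (2 * M))); [apply Rmult_lt_compat_l; lra|].
          right; field; lra.
        - unfold B. apply Rmult_le_compat_l; lra. }
      assert (F1 : forall w, y <= w <= y + s ->
        Cmod (cint (fun u => E1 u w) x (x + s) - (P (g (x + s)%R w) - P (g x w))) <= s * (B * M)).
      { intros w Hw. replace (s * (B * M)) with ((x + s - x) * (B * M)) by ring.
        apply (edge_integral G (fun u => g u w) (fun u => g1 u w)); auto; try lra.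
        - intros t Ht. apply H5; unfold in01; lra.
        - intros t Ht. apply Gc; unfold in01; lra. }
      assert (F2 : forall w, x <= w <= x + s ->
        Cmod (cint (fun v => E2 w v) y (y + s) - (P (g w (y + s)%R) - P (g w y))) <= s * (B * M)).
      { intros w Hw. replace (s * (B * M)) with ((y + s - y) * (B * M)) by ring.
        apply (edge_integral G (fun v => g w v) (fun v => g2 w v)); auto; try lra.
        - intros t Ht. apply H5; unfold in01; lra.
        - intros t Ht. apply Gc; unfold in01; lra. }
      pose proof (F1 y ltac:(lra)) as A1. pose proof (F1 (y + s) ltac:(lra)) as A2.
      pose proof (F2 x ltac:(lra)) as A3. pose proof (F2 (x + s) ltac:(lra)) as A4.
      unfold J.
      match type of A1 with Cmod ?t <= _ => set (t1 := t) in * end.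
      match type of A2 with Cmod ?t <= _ => set (t2 := t) in * end.
      match type of A3 with Cmod ?t <= _ => set (t3 := t) in * end.
      match type of A4 with Cmod ?t <= _ => set (t4 := t) in * end.
      match goal with |- Cmod ?t <= _ => replace t with ((t1 + t4 - t2) - t3)%C by (unfold t1, t2, t3, t4; ring) end.
      pose proof (Cmod_sub_le (t1 + t4 - t2) t3). pose proof (Cmod_sub_le (t1 + t4) t2).
      pose proof (Cmod_triangle t1 t4).
      apply Rle_trans with (4 * (s * (B * M))); [lra|].
      right. unfold B. field. lra. }
  unfold J in HJ. rewrite !Rplus_0_l in HJ.
  match type of HJ with (?a + ?b - ?c - ?d)%C = _ =>
    change ((a + b)%C = (c + d)%C);
    replace (a + b)%C with ((a + b - c - d) + (c + d))%C by ring; rewrite HJ; ring end.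
Qed.

(** * Cauchy's formula and its consequences *)

Definition holo (r : R) (F : C -> C) : Prop :=
  forall z, Cmod z < r -> exists l, deriv_at idC F z l.

Lemma holo_on_disc r F : holo_on (Defs.disc r) F <-> holo r F.
Proof.
  unfold holo_on, holo, Defs.disc.
  split; intros H z Hz; destruct (H z Hz) as [l Hl]; exists l; apply is_derive_deriv_at; exact Hl.
Qed.

Definition circ (t : R) : C := (cos (2 * PI * t), sin (2 * PI * t)).
Definition twopii : C := (0, 2 * PI).

Lemma Cmod_circ t : Cmod (circ t) = 1.
Proof.
  unfold circ, Cmod; simpl.
  replace (_ + _) with 1; [apply sqrt_1|].
  pose proof (sin2_cos2 (2 * PI * t)) as H. unfold Rsqr in H. lra.
Qed.

Lemma circ_0 : circ 0 = 1%C.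
Proof. unfold circ. rewrite Rmult_0_r, cos_0, sin_0. reflexivity. Qed.

Lemma circ_1 : circ 1 = 1%C.
Proof. unfold circ. rewrite Rmult_1_r, cos_2PI, sin_2PI. reflexivity. Qed.

Lemma Cmod_twopii : Cmod twopii = 2 * PI.
Proof.
  replace twopii with (RtoC (2 * PI) * Ci)%C by (unfold twopii, Ci, RtoC, Cmult; simpl; f_equal; ring).
  rewrite Cmod_mult, Cmod_Ci, Cmod_R, Rmult_1_r. apply Rabs_right. pose proof PI_RGT_0. lra.
Qed.

Lemma deriv_at_RtoC (f : R -> R) t a :
  derivable_pt_lim f t a -> deriv_at RtoC (fun t => RtoC (f t)) t (RtoC a).
Proof.
  intros H e He. destruct (H e He) as [d Hd]. exists d; split; [apply cond_pos|].
  intros y. rewrite <- !RtoC_minus, <- RtoC_mult, <- RtoC_minus, !Cmod_R. intros Hy.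
  destruct (Req_dec y t) as [->|n].
  - replace (f t - f t - a * (t - t)) with 0 by ring. rewrite Rminus_diag, Rabs_R0. lra.
  - specialize (Hd (y - t) ltac:(lra) Hy). replace (t + (y - t)) with y in Hd by ring.
    replace (f y - f t - a * (y - t)) with (((f y - f t) / (y - t) - a) * (y - t)) by (field; lra).
    rewrite Rabs_mult. apply Rmult_le_compat_r; [apply Rabs_pos|]. left; exact Hd.
Qed.

Lemma deriv_at_circ t : deriv_at RtoC circ t (twopii * circ t)%C.
Proof.
  assert (H1 : derivable_pt_lim (fun t => cos (2 * PI * t)) t (- sin (2 * PI * t) * (2 * PI))).
  { apply is_derive_Reals. auto_derive; auto. ring. }
  assert (H2 : derivable_pt_lim (fun t => sin (2 * PI * t)) t (cos (2 * PI * t) * (2 * PI))).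
  { apply is_derive_Reals. auto_derive; auto. ring. }
  apply deriv_at_RtoC in H1. apply deriv_at_RtoC in H2.
  eapply deriv_at_ext;
    [| |apply deriv_at_plus; [exact H1|apply deriv_at_mult; [apply (deriv_at_const _ Ci)|exact H2]]].
  - intros y. unfold circ, Ci, RtoC, Cplus, Cmult; simpl. f_equal; ring.
  - unfold circ, twopii, Ci, RtoC, Cplus, Cmult; simpl. f_equal; ring.
Qed.

Lemma cont_at_circ t : cont_at RtoC circ t.
Proof. eapply deriv_at_cont. apply deriv_at_circ. Qed.

Lemma radius_sub_neq (r : R) (z : C) t : Cmod z < r -> (r * circ t - z)%C <> 0%C.
Proof.
  intros Hz E. assert (E' : z = (r * circ t)%C) by (rewrite <- (Cplus_0_l z), <- E; ring).
  rewrite E', Cmod_mult, Cmod_circ, Cmod_R in Hz. pose proof (Rle_abs r). lra.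
Qed.

Lemma radius_sub_ge (r : R) (z : C) t : 0 < r -> r - Cmod z <= Cmod (r * circ t - z).
Proof.
  intros Hr. pose proof (Cmod_le_sub (r * circ t) z) as H.
  rewrite Cmod_mult, Cmod_circ, Cmod_R, Rabs_right in H by lra. lra.
Qed.

(** The form [dw / (w - z)] pulled back along [w = r * circ t]. *)
Definition cauchy_kernel (r : R) (z : C) (t : R) : C :=
  (/ (r * circ t - z) * (r * (twopii * circ t)))%C.

Lemma cont_at_cauchy_kernel r z t : Cmod z < r -> cont_at RtoC (cauchy_kernel r z) t.
Proof.
  intros Hz. apply cont_at_mult.
  - apply cont_at_inv; [apply radius_sub_neq; auto|].
    apply cont_at_plus; [|apply cont_at_const].
    apply cont_at_mult; [apply cont_at_const|apply cont_at_circ].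
  - repeat (apply cont_at_mult; [apply cont_at_const|]). apply cont_at_circ.
Qed.

Lemma cauchy_kernel_bound r z t :
  Cmod z < r -> 0 < r -> Cmod (cauchy_kernel r z t) <= 2 * PI * r / (r - Cmod z).
Proof.
  intros Hz Hr. unfold cauchy_kernel.
  rewrite !Cmod_mult, Cmod_inv by (apply radius_sub_neq; auto).
  rewrite Cmod_twopii, Cmod_circ, Cmod_R, Rabs_right by lra.
  pose proof (radius_sub_ge r z t Hr). pose proof PI_RGT_0.
  replace (2 * PI * r / (r - Cmod z)) with (/ (r - Cmod z) * (r * (2 * PI * 1))) by (field; lra).
  apply Rmult_le_compat_r; [nra|]. apply Rinv_le_contravar; lra.
Qed.

(* The circle [r e^{it} - u z] moves from centre [0] ([u = 0]) to centre [-z] ([u = 1]) without meeting [0]. *)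
Lemma cauchy_kernel_integral r z : 0 < r -> Cmod z < r -> cint (cauchy_kernel r z) 0 1 = twopii.
Proof.
  intros Hr Hz. pose proof PI_RGT_0 as Hpi. pose proof (Cmod_ge_0 z) as Hz0.
  pose (g := fun u v : R => (r * circ v + RtoC u * (- z))%C).
  assert (Hs : smooth_square g (fun _ _ => - z)%C (fun _ v => (r * (twopii * circ v))%C)
                 (Cmod z + r * (2 * PI))).
  { repeat split.
    - intros u v. eapply deriv_at_ext;
        [| |apply deriv_at_plus; [apply deriv_at_const|apply deriv_at_mult; [apply deriv_at_param|apply deriv_at_const]]].
      + intros y. reflexivity.
      + simpl; ring.
    - intros u v. eapply deriv_at_ext;
        [| |apply deriv_at_plus; [apply deriv_at_mult; [apply deriv_at_const|apply deriv_at_circ]|apply deriv_at_const]].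
      + intros y. reflexivity.
      + simpl; ring.
    - intros; apply cont_at_const.
    - intros. repeat (apply cont_at_mult; [apply cont_at_const|]). apply cont_at_circ.
    - rewrite Cmod_opp. nra.
    - rewrite !Cmod_mult, Cmod_twopii, Cmod_circ, Cmod_R, Rabs_right by lra. lra. }
  assert (Hn : forall u v, in01 u -> in01 v -> g u v <> 0%C).
  { intros u v Hu Hv. unfold g.
    replace (r * circ v + u * - z)%C with (r * circ v - u * z)%C by ring. apply radius_sub_neq.
    unfold in01 in Hu. rewrite Cmod_mult, Cmod_R, Rabs_right by lra. nra. }
  pose proof (goursat Cinv g _ _ (Cmod z + r * (2 * PI)) ltac:(nra) Hs) as H.
  lapply H; clear H.
  - intros H. unfold g in H at 1 3. rewrite circ_0, circ_1 in H.
    (* The curves are closed, so the edges [v = 0] and [v = 1] carry the same integral and cancel;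
       at [u = 0] the remaining integrand is the constant [twopii]. *)
    match type of H with (?a + ?b = ?c + ?d)%C =>
      assert (E : b = d) by (replace b with ((a + b) + - a)%C by ring; rewrite H; ring) end.
    rewrite (cint_ext (cauchy_kernel r z) (fun v => / g 1 v * (r * (twopii * circ v)))%C) by
      (try lra; intros; unfold cauchy_kernel, g; do 2 f_equal; ring).
    rewrite E.
    rewrite (cint_ext _ (fun v => twopii)); [|lra|].
    2:{ intros v _. assert (Hr' : RtoC r <> 0%C) by (intros K; apply RtoC_inj in K; lra).
        assert (Hv : circ v <> 0%C) by (apply Cmod_gt_0; rewrite Cmod_circ; lra).
        unfold g. replace (r * circ v + 0 * - z)%C with (r * circ v)%C by ring. field; auto. }
    rewrite (cint_deriv (fun t => twopii * RtoC t)%C (fun _ => twopii) 0 1); try lra.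
    + ring.
    + intros t _. eapply deriv_at_ext;
        [| |apply deriv_at_mult; [apply (deriv_at_const _ twopii)|apply deriv_at_param]].
      * intros; reflexivity.
      * simpl; ring.
    + intros; apply cont_at_const.
  - intros u v Hu Hv. exists (- (1) / (g u v * g u v))%C.
    apply (deriv_at_inv idC idC); [apply Hn; auto|apply deriv_at_param].
Qed.

(* Shrinks the circle of radius [r] homothetically towards [z], applied to the
   difference quotient of [F] at [z]. *)
Lemma cauchy_formula F r0 r z :
  holo r0 F -> 0 < r < r0 -> Cmod z < r ->
  cint (fun t => F (r * circ t)%C * cauchy_kernel r z t)%C 0 1 = (F z * twopii)%C.
Proof.
  intros HF Hr Hz. pose proof PI_RGT_0 as Hpi. pose proof (Cmod_ge_0 z) as Hz0.
  pose (Q := fun x : C => ((F x + - F z) * / (x + - z))%C).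
  assert (Fc : forall x, Cmod x < r0 -> cont_at idC F x).
  { intros x Hx. destruct (HF x Hx). eapply deriv_at_cont; eauto. }
  assert (Hc : forall t, Cmod (r * circ t) = r).
  { intros t. rewrite Cmod_mult, Cmod_circ, Cmod_R, Rabs_right; lra. }
  assert (Kc : forall t, cont_at RtoC (cauchy_kernel r z) t)
    by (intros; apply cont_at_cauchy_kernel; auto).
  assert (Fcc : forall t, cont_at RtoC (fun t => F (r * circ t)%C) t).
  { intros t. apply (cont_at_comp RtoC (fun t => (r * circ t)%C)).
    - apply Fc. rewrite Hc. lra.
    - apply cont_at_mult; [apply cont_at_const|apply cont_at_circ]. }
  set (I := cint (fun t => (F (r * circ t)%C + - F z) * cauchy_kernel r z t)%C 0 1).
  assert (HI : I = 0%C).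
  { apply Cmod_small_eq0. intros e He.
    set (N := 2 * PI * r / (r - Cmod z)).
    assert (HN : 0 < N) by (apply Rdiv_lt_0_compat; nra).
    destruct (Fc z ltac:(lra) (e / N)) as [d [Hd Hd']]; [apply Rdiv_lt_0_compat; auto|].
    unfold idC in Hd'.
    (* The homothety stops at a ratio [a > 0], so that the quotient [Q] is never evaluated at [z].
       The factor [3] puts the final circle strictly within [d] of [z], as [2 * r] bounds the
       distance from [z] to the initial one. *)
    set (a := Rmin (1 / 2) (d / (3 * r))).
    assert (Ha0 : 0 < a) by (apply Rmin_pos; [lra|apply Rdiv_lt_0_compat; lra]).
    assert (Ha1 : a <= 1 / 2) by apply Rmin_l.
    assert (Had : a * (2 * r) < d).
    { apply Rle_lt_trans with (d / (3 * r) * (2 * r)); [apply Rmult_le_compat_r; [lra|apply Rmin_r]|].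
      replace (d / (3 * r) * (2 * r)) with (2 / 3 * d) by (field; lra). lra. }
    pose (tau := fun u : R => (a + u * (1 - a))).
    pose (g := fun u v : R => (z + (a + RtoC u * (1 - a)) * (r * circ v + - z))%C).
    assert (Hg : forall u v, g u v = (z + RtoC (tau u) * (r * circ v - z))%C).
    { intros. unfold g, tau. rewrite RtoC_plus, RtoC_mult, RtoC_minus. ring. }
    assert (Hd0 : forall v, Cmod (r * circ v - z) <= 2 * r).
    { intros v. pose proof (Cmod_sub_le (r * circ v) z). rewrite Hc in H. lra. }
    assert (Htau : forall u, in01 u -> a <= tau u <= 1) by (intros u Hu; unfold in01, tau in *; nra).
    assert (Hs : smooth_square g (fun _ v => (1 - a) * (r * circ v + - z))%C
                   (fun u v => RtoC (tau u) * (r * (twopii * circ v)))%C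
                   (2 * r + r * (2 * PI))).
    { repeat split.
      - intros u v. eapply deriv_at_ext;
          [| |apply deriv_at_plus; [apply (deriv_at_const _ z)|
              apply deriv_at_mult; [apply deriv_at_plus; [apply (deriv_at_const _ (RtoC a))|
                apply deriv_at_mult; [apply deriv_at_param|apply (deriv_at_const _ (1 - a)%C)]]
              |apply (deriv_at_const _ (r * circ v + - z)%C)]]].
        + intros y. reflexivity.
        + simpl; ring.
      - intros u v. eapply deriv_at_ext;
          [| |apply deriv_at_plus; [apply (deriv_at_const _ z)|
              apply deriv_at_mult; [apply (deriv_at_const _ (RtoC (tau u)))|
                apply deriv_at_plus; [apply deriv_at_mult; [apply (deriv_at_const _ (RtoC r))|apply deriv_at_circ]
                                     |apply (deriv_at_const _ (- z)%C)]]]].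
        + intros y. rewrite Hg. ring.
        + simpl; ring.
      - intros; apply cont_at_const.
      - intros. repeat (apply cont_at_mult; [apply cont_at_const|]). apply cont_at_circ.
      - rewrite Cmod_mult, <- RtoC_minus, Cmod_R, Rabs_right by lra.
        specialize (Hd0 v). unfold Cminus in Hd0. pose proof (Cmod_ge_0 (r * circ v + - z)). nra.
      - rewrite !Cmod_mult, Cmod_twopii, Cmod_circ, !Cmod_R.
        specialize (Htau u H). rewrite !Rabs_right by lra.
        assert (0 < r * (2 * PI * 1)) by (apply Rmult_lt_0_compat; lra). nra. }
    assert (Hgz : forall u v, in01 u -> (g u v + - z)%C <> 0%C).
    { intros u v Hu. rewrite Hg.
      replace (z + tau u * (r * circ v - z) + - z)%C with (tau u * (r * circ v - z))%C by ring.
      apply Cmult_neq_0; [|apply radius_sub_neq; auto].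
      specialize (Htau u Hu). intros E; apply RtoC_inj in E; lra. }
    assert (Hgr : forall u v, in01 u -> Cmod (g u v) < r0).
    { intros u v Hu. rewrite Hg. specialize (Htau u Hu).
      replace (z + tau u * (r * circ v - z))%C with (RtoC (1 - tau u) * z + tau u * (r * circ v))%C
        by (rewrite RtoC_minus; ring).
      eapply Rle_lt_trans; [apply Cmod_triangle|].
      rewrite !Cmod_mult, Cmod_circ, !Cmod_R, !Rabs_right by lra. nra. }
    pose proof (goursat Q g _ _ (2 * r + r * (2 * PI)) ltac:(nra) Hs) as H.
    lapply H; clear H.
    2:{ intros u v Hu Hv. destruct (HF (g u v) (Hgr u v Hu)) as [l Hl].
        eexists. unfold Q. apply deriv_at_mult.
        - apply deriv_at_plus; [exact Hl|apply deriv_at_const].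
        - apply (deriv_at_inv idC (fun x => idC x + - z)%C); [apply Hgz; auto|].
          apply deriv_at_plus; [apply deriv_at_param|apply deriv_at_const]. }
    intros H.
    match type of H with (?p + ?q = ?p' + ?q')%C =>
      assert (E0 : p = p') by (apply cint_ext; [lra|]; intros; unfold g; rewrite circ_0, circ_1; reflexivity);
      assert (E : q = q') by (replace q with ((p + q) + - p)%C by ring; rewrite H, E0; ring) end.
    assert (EI : I = cint (fun v => Q (g 0 v) * (RtoC (tau 0) * (r * (twopii * circ v))))%C 0 1).
    { rewrite <- E. apply cint_ext; [lra|]. intros t _. unfold Q.
      assert (T : tau 1 = 1) by (unfold tau; ring). rewrite Hg, T.
      replace (z + 1 * (r * circ t - z))%C with (r * circ t)%C by ring.
      unfold cauchy_kernel, Cminus. ring. }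
    rewrite EI.
    (* [dw / (w - z)] is invariant under homotheties centred at [z], so the kernel of the shrunk
       circle is that of the original one, with a bound independent of [a]. *)
    rewrite (cint_ext _ (fun v => (F (g 0 v) + - F z) * cauchy_kernel r z v)%C); [|lra|].
    2:{ intros t _. unfold Q, cauchy_kernel. rewrite !Hg.
        assert (T : tau 0 = a) by (unfold tau; ring). rewrite T.
        field. split; [apply radius_sub_neq; auto|].
        replace (z + a * (r * circ t - z) + - z)%C with (a * (r * circ t - z))%C by ring.
        apply Cmult_neq_0; [|apply radius_sub_neq; auto]. intros K; apply RtoC_inj in K; lra. }
    apply Rle_trans with ((1 - 0) * (e / N * N)); [|right; field; lra].
    assert (H0 : in01 0) by (unfold in01; lra).
    apply cint_bound; [lra| |].
    + apply cint_ex_cont; [lra|]. intros t _. apply cont_at_mult; auto.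
      apply cont_at_plus; [|apply cont_at_const].
      apply (cont_at_comp RtoC (fun v => g 0 v)); [apply Fc; apply Hgr; auto|].
      destruct Hs as (_ & Hs & _). eapply deriv_at_cont. apply Hs.
    + intros t _. rewrite Cmod_mult. apply Rmult_le_compat; try apply Cmod_ge_0.
      * left. apply Hd'. rewrite Hg.
        assert (T : tau 0 = a) by (unfold tau; ring). rewrite T.
        replace (z + a * (r * circ t - z) - z)%C with (a * (r * circ t - z))%C by ring.
        rewrite Cmod_mult, Cmod_R, Rabs_right by lra. specialize (Hd0 t). nra.
      * apply cauchy_kernel_bound; lra. }
  rewrite <- (cauchy_kernel_integral r z) by lra. rewrite <- cint_scal by (apply cint_ex_cont; [lra|auto]).
  replace (cint (fun t => F (r * circ t)%C * cauchy_kernel r z t)%C 0 1)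
    with (I + cint (fun t => F z * cauchy_kernel r z t)%C 0 1)%C.
  - rewrite HI. ring.
  - unfold I. rewrite <- cint_plus.
    + apply cint_ext; [lra|]. intros; ring.
    + apply cint_ex_cont; [lra|]. intros t _. apply cont_at_mult; auto.
      apply cont_at_plus; auto using cont_at_const.
    + apply cint_ex_cont; [lra|]. intros t _. apply cont_at_mult; auto using cont_at_const.
Qed.

Lemma holo_const r c : holo r (fun _ => c).
Proof. intros z _. eexists. apply deriv_at_const. Qed.

Lemma holo_id r : holo r (fun z => z).
Proof. intros z _. eexists. apply (deriv_at_param idC). Qed.

Lemma holo_plus r F G : holo r F -> holo r G -> holo r (fun z => F z + G z)%C.
Proof.
  intros HF HG z Hz. destruct (HF z Hz). destruct (HG z Hz). eexists. apply deriv_at_plus; eauto.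
Qed.

Lemma holo_mult r F G : holo r F -> holo r G -> holo r (fun z => F z * G z)%C.
Proof.
  intros HF HG z Hz. destruct (HF z Hz). destruct (HG z Hz). eexists. apply deriv_at_mult; eauto.
Qed.

Lemma holo_comp r s F G :
  holo s F -> holo r G -> (forall z, Cmod z < r -> Cmod (G z) < s) -> holo r (fun z => F (G z)).
Proof.
  intros HF HG H z Hz. destruct (HG z Hz) as [b Hb]. destruct (HF (G z) (H z Hz)) as [a Ha].
  exists (a * b)%C. apply deriv_at_comp; auto.
Qed.

Lemma holo_mono r s F : s <= r -> holo r F -> holo s F.
Proof. intros Hs H z Hz. apply H. lra. Qed.

Lemma holo_ext r F G : (forall z, F z = G z) -> holo r F -> holo r G.
Proof.
  intros E H z Hz. destruct (H z Hz) as [l Hl]. exists l. eapply deriv_at_ext; eauto.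
Qed.

Lemma holo_cont r F z : holo r F -> Cmod z < r -> cont_at idC F z.
Proof. intros H Hz. destruct (H z Hz). eapply deriv_at_cont; eauto. Qed.

Lemma circle_cont F r0 r t : holo r0 F -> 0 < r < r0 -> cont_at RtoC (fun t => F (r * circ t)%C) t.
Proof.
  intros HF Hr. apply (cont_at_comp RtoC (fun t => (r * circ t)%C)).
  - apply holo_cont with r0; auto. rewrite Cmod_mult, Cmod_circ, Cmod_R, Rabs_right; lra.
  - apply cont_at_mult; [apply cont_at_const|apply cont_at_circ].
Qed.

Lemma circle_bounded F r0 r :
  holo r0 F -> 0 < r < r0 -> exists M, 0 < M /\ forall t, 0 <= t <= 1 -> Cmod (F (r * circ t)%C) <= M.
Proof.
  intros HF Hr.
  destruct (continuity_ab_maj (fun t => Cmod (F (r * circ t)%C)) 0 1) as [tm [Ht _]]; [lra| |].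
  - intros t _ e He. destruct (circle_cont F r0 r t HF Hr e He) as [d [Hd Hd']].
    exists d; split; auto. intros y [_ Hy]. specialize (Hd' y).
    rewrite Cmod_RtoC_sub in Hd'. specialize (Hd' Hy). simpl. unfold Rdist.
    eapply Rle_lt_trans; [|exact Hd']. apply Rabs_le.
    pose proof (Cmod_le_sub (F (r * circ y)%C) (F (r * circ t)%C)).
    pose proof (Cmod_le_sub (F (r * circ t)%C) (F (r * circ y)%C)) as H2.
    rewrite (Cmod_sub_sym (F (r * circ t)%C)) in H2. lra.
  - exists (Cmod (F (r * circ tm)%C) + 1). split.
    + pose proof (Cmod_ge_0 (F (r * circ tm)%C)). lra.
    + intros t Hi. specialize (Ht t Hi). simpl in Ht. lra.
Qed.

(** The factor [r / (r - Cmod z)] comes from the kernel and is independent of [F]; it stays fixed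
    when the identity theorem applies the bound to all the functions [F z / z ^ n]. *)
Lemma cauchy_bound F r0 r z M :
  holo r0 F -> 0 < r < r0 -> Cmod z < r ->
  (forall t, 0 <= t <= 1 -> Cmod (F (r * circ t)%C) <= M) -> Cmod (F z) <= M * (r / (r - Cmod z)).
Proof.
  intros HF Hr Hz HM. pose proof PI_RGT_0.
  assert (E := cauchy_formula F r0 r z HF Hr Hz).
  assert (B : Cmod (F z) * (2 * PI) <= (1 - 0) * (M * (2 * PI * r / (r - Cmod z)))).
  { rewrite <- Cmod_twopii at 1. rewrite <- Cmod_mult, <- E. apply cint_bound; [lra| |].
    - apply cint_ex_cont; [lra|]. intros t _.
      apply cont_at_mult; [eapply circle_cont; eauto|apply cont_at_cauchy_kernel; lra].
    - intros t Ht. rewrite Cmod_mult.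
      apply Rmult_le_compat; try apply Cmod_ge_0; [auto|apply cauchy_kernel_bound; lra]. }
  apply Rmult_le_reg_r with (2 * PI); [lra|].
  replace (M * (r / (r - Cmod z)) * (2 * PI)) with ((1 - 0) * (M * (2 * PI * r / (r - Cmod z))))
    by (field; lra).
  exact B.
Qed.

(** The circle of radius [r / 2] stays at distance at least [r / 4] from both points, so the two
    kernels differ by at most [2 * PI * (4 / r) ^ 2 * (r / 2)] times [Cmod (z - z')]. *)
Lemma cauchy_lipschitz F r M z z' :
  0 < r -> holo r F -> (forall z, Cmod z < r -> Cmod (F z) <= M) ->
  Cmod z <= r / 4 -> Cmod z' <= r / 4 -> Cmod (F z - F z') <= 8 * M / r * Cmod (z - z').
Proof.
  intros Hr HF HM Hz Hz'. pose proof PI_RGT_0.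
  set (s := r / 2). assert (Hs : 0 < s < r) by (unfold s; lra).
  assert (Hcs : forall t, Cmod (s * circ t) = s).
  { intros t. rewrite Cmod_mult, Cmod_circ, Cmod_R, Rabs_right; lra. }
  assert (E := cauchy_formula F r s z HF Hs ltac:(unfold s; lra)).
  assert (E' := cauchy_formula F r s z' HF Hs ltac:(unfold s; lra)).
  assert (Kc : forall z t, Cmod z <= r / 4 ->
    cont_at RtoC (fun t => F (s * circ t)%C * cauchy_kernel s z t)%C t).
  { intros w t Hw. apply cont_at_mult; [eapply circle_cont; eauto|].
    apply cont_at_cauchy_kernel; unfold s; lra. }
  assert (B : Cmod (F z - F z') * (2 * PI) <= (1 - 0) * (M * (2 * PI * (8 / r) * Cmod (z - z')))).
  { rewrite <- Cmod_twopii at 1. rewrite <- Cmod_mult.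
    replace ((F z - F z') * twopii)%C with (F z * twopii - F z' * twopii)%C by ring.
    rewrite <- E, <- E', <- cint_minus by (apply cint_ex_cont; [lra|auto]).
    apply cint_bound; [lra| |].
    - apply cint_ex_cont; [lra|]. intros t _.
      apply cont_at_ext with (fun t => F (s * circ t) * cauchy_kernel s z t
        + (- (1)) * (F (s * circ t) * cauchy_kernel s z' t))%C; [intros; ring|].
      apply cont_at_plus; auto. apply cont_at_mult; auto using cont_at_const.
    - intros t Ht.
      assert (N1 : (s * circ t - z)%C <> 0%C) by (apply radius_sub_neq; unfold s; lra).
      assert (N2 : (s * circ t - z')%C <> 0%C) by (apply radius_sub_neq; unfold s; lra).
      replace (F (s * circ t) * cauchy_kernel s z t - F (s * circ t) * cauchy_kernel s z' t)%C
        with (F (s * circ t) * ((/ (s * circ t - z) * / (s * circ t - z')) * (s * circ t) * twopii * (z - z')))%C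
        by (unfold cauchy_kernel; field; auto).
      rewrite Cmod_mult. apply Rmult_le_compat; try apply Cmod_ge_0; [apply HM; rewrite Hcs; lra|].
      rewrite (Cmod_mult _ (z - z')). apply Rmult_le_compat_r; [apply Cmod_ge_0|].
      rewrite (Cmod_mult _ twopii), Cmod_twopii, (Cmod_mult _ (s * circ t)), Hcs, Cmod_mult, !Cmod_inv by auto.
      pose proof (radius_sub_ge s z t ltac:(lra)). pose proof (radius_sub_ge s z' t ltac:(lra)).
      assert (A : forall x, r / 4 <= x -> / x <= 4 / r).
      { intros x Hx. replace (4 / r) with (/ (r / 4)) by (field; lra). apply Rinv_le_contravar; lra. }
      assert (A1 := A (Cmod (s * circ t - z)) ltac:(unfold s in *; lra)).
      assert (A2 := A (Cmod (s * circ t - z')) ltac:(unfold s in *; lra)).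
      replace (2 * PI * (8 / r)) with (4 / r * (4 / r) * s * (2 * PI)) by (unfold s; field; lra).
      apply Rmult_le_compat_r; [lra|]. apply Rmult_le_compat_r; [lra|].
      apply Rmult_le_compat; auto; left; apply Rinv_0_lt_compat; apply Cmod_gt_0; auto. }
  apply Rmult_le_reg_r with (2 * PI); [lra|].
  replace (8 * M / r * Cmod (z - z') * (2 * PI)) with ((1 - 0) * (M * (2 * PI * (8 / r) * Cmod (z - z'))))
    by (field; lra).
  exact B.
Qed.

(* If [F] vanishes near [0], every [F z / z ^ n] is holomorphic (Rocq's [/ 0 = 0]
   is harmless there), and Cauchy's bound yields [F z = O((|z| / r) ^ n)]. *)
Lemma identity_theorem F r0 d :
  holo r0 F -> 0 < d -> (forall z, Cmod z < d -> F z = 0%C) ->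
  forall z, Cmod z < r0 -> F z = 0%C.
Proof.
  intros HF Hd H0 z Hz.
  destruct (Rlt_dec (Cmod z) d) as [|Hzd]; [auto|].
  assert (Hz0 : 0 < Cmod z) by lra.
  set (r := (Cmod z + r0) / 2). assert (Hr : Cmod z < r < r0) by (unfold r; lra).
  destruct (circle_bounded F r0 r HF ltac:(lra)) as [M [HM HM']].
  assert (Hpow : forall n (x : C), x <> 0%C -> exists l, deriv_at idC (fun x => (/ x) ^ n)%C x l).
  { intros n x Hx. induction n as [|n [l Hl]].
    - exists 0%C. apply (deriv_at_const idC 1%C).
    - eexists. simpl. apply deriv_at_mult; [apply (deriv_at_inv idC idC); [exact Hx|apply deriv_at_param]|exact Hl]. }
  assert (HG : forall n, holo r0 (fun x => F x * (/ x) ^ n)%C).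
  { intros n x Hx. destruct (Rlt_dec (Cmod x) d) as [Hxd|Hxd].
    - exists 0%C. apply deriv_at_ext_loc with (fun _ => 0%C) (d - Cmod x); [lra| |apply deriv_at_const].
      intros y Hy. rewrite H0; [ring|]. pose proof (Cmod_le_sub y x). lra.
    - destruct (HF x Hx) as [a Ha]. destruct (Hpow n x) as [b Hb]; [apply Cmod_gt_0; lra|].
      eexists. apply deriv_at_mult; eauto. }
  assert (B : forall n, Cmod (F z) <= M * (r / (r - Cmod z)) * (Cmod z / r) ^ n).
  { intros n.
    assert (C := cauchy_bound _ r0 r z (M * (/ r) ^ n) (HG n) ltac:(lra) ltac:(lra)).
    lapply C; clear C.
    - intros C. rewrite Cmod_mult, Cmod_pow, Cmod_inv, pow_inv in C by (apply Cmod_gt_0; auto).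
      assert (0 < Cmod z ^ n) by (apply pow_lt; auto).
      apply Rmult_le_compat_r with (r := Cmod z ^ n) in C; [|lra].
      rewrite Rmult_assoc, Rinv_l, Rmult_1_r in C by lra.
      eapply Rle_trans; [exact C|]. right. unfold Rdiv. rewrite !Rpow_mult_distr. ring.
    - intros t Ht. assert (Hc : Cmod (r * circ t) = r).
      { rewrite Cmod_mult, Cmod_circ, Cmod_R, Rabs_right; lra. }
      rewrite Cmod_mult, Cmod_pow, Cmod_inv, Hc by (apply Cmod_gt_0; lra).
      apply Rmult_le_compat_r; [apply pow_le; left; apply Rinv_0_lt_compat; lra|auto]. }
  apply Cmod_small_eq0. intros e He.
  set (N := M * (r / (r - Cmod z))) in *.
  assert (HN : 0 < N) by (apply Rmult_lt_0_compat; auto; apply Rdiv_lt_0_compat; lra).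
  assert (Hq : 0 <= Cmod z / r < 1).
  { split; [apply Rlt_le, Rdiv_lt_0_compat; lra|]. apply Rmult_lt_reg_r with r; [lra|].
    unfold Rdiv. rewrite Rmult_assoc, Rinv_l; lra. }
  destruct (pow_lt_1_zero (Cmod z / r)) with (y := e / N) as [n Hn].
  - rewrite Rabs_right; lra.
  - apply Rdiv_lt_0_compat; auto.
  - specialize (Hn n (le_n n)). specialize (B n).
    rewrite Rabs_right in Hn by (apply Rle_ge, pow_le; lra).
    apply Rle_trans with (1 := B). apply Rle_trans with (N * (e / N)); [apply Rmult_le_compat_l; lra|].
    right; field; lra.
Qed.

(** * Perturbations of a local diffeomorphism *)

(** On a disc of radius [rho] the tangent remainder is at most [eta / 8 * rho], and
    [cauchy_lipschitz] turns this sup bound into the Lipschitz constant [eta]. Differentiability at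
    [0] thus upgrades to a two-point estimate. *)
Lemma strict_derivative r F l eta :
  0 < r -> holo r F -> deriv_at idC F 0%C l -> 0 < eta ->
  exists s, 0 < s <= r /\ forall z z', Cmod z < s -> Cmod z' < s ->
    Cmod (F z - F z' - l * (z - z')) <= eta * Cmod (z - z').
Proof.
  intros Hr HF Hl Heta.
  destruct (Hl (eta / 8)) as [d [Hd Hd']]; [lra|]. unfold idC in Hd'.
  set (rho := Rmin r d). assert (Hrho : 0 < rho) by (apply Rmin_pos; auto).
  pose proof (Rmin_l r d : rho <= r). pose proof (Rmin_r r d : rho <= d).
  exists (rho / 4). split; [lra|]. intros z z' Hz Hz'.
  pose (psi := fun z : C => (F z + ((- F 0) + (- l) * z))%C).
  assert (L : Cmod (psi z - psi z') <= 8 * (eta / 8 * rho) / rho * Cmod (z - z')).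
  { apply cauchy_lipschitz; try lra.
    - apply holo_plus; [apply holo_mono with r; auto|]. apply holo_plus; [apply holo_const|].
      apply holo_mult; [apply holo_const|apply holo_id].
    - intros w Hw. specialize (Hd' w). replace (w - 0)%C with w in Hd' by ring.
      unfold psi. replace (F w + (- F 0 + - l * w))%C with (F w - F 0 - l * w)%C by ring.
      eapply Rle_trans; [apply Hd'; lra|]. apply Rmult_le_compat_l; lra. }
  unfold psi in L.
  replace (F z - F z' - l * (z - z'))%C
    with (F z + (- F 0 + - l * z) - (F z' + (- F 0 + - l * z')))%C by ring.
  replace (8 * (eta / 8 * rho) / rho) with eta in L by (field; lra). exact L.
Qed.

Lemma contraction_fixpoint (T : C -> C) rho :
  0 < rho ->
  (forall z z', Cmod z <= rho -> Cmod z' <= rho -> Cmod (T z - T z') <= / 2 * Cmod (z - z')) ->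
  Cmod (T 0%C) <= rho / 2 -> exists z, Cmod z <= rho /\ T z = z.
Proof.
  intros Hrho HT H0.
  assert (Hin : forall z, Cmod z <= rho -> Cmod (T z) <= rho).
  { intros z Hz. pose proof (Cmod_le_sub (T z) (T 0%C)).
    pose proof (HT z 0%C Hz ltac:(rewrite Cmod_0; lra)) as A.
    replace (z - 0)%C with z in A by ring. lra. }
  pose (u := fun n => Nat.iter n T 0%C).
  assert (Hu : forall n, Cmod (u n) <= rho).
  { induction n; simpl; [rewrite Cmod_0; lra|apply Hin; exact IHn]. }
  assert (Hd : forall n k, Cmod (u (n + k)%nat - u n) <= rho * (/ 2) ^ n).
  { induction n; intros k.
    - simpl. replace (u k - 0)%C with (u k) by ring. rewrite Rmult_1_r. apply Hu.
    - change (u (S n + k)%nat) with (T (u (n + k)%nat)). change (u (S n)) with (T (u n)).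
      eapply Rle_trans; [apply HT; apply Hu|]. specialize (IHn k). simpl. lra. }
  assert (Hsmall : forall e, 0 < e -> exists N, forall n m, (n >= N)%nat -> (m >= N)%nat ->
            Cmod (u n - u m) < e).
  { intros e He.
    destruct (pow_lt_1_zero (/ 2)) with (y := e / (2 * rho)) as [N HN].
    - rewrite Rabs_right; lra.
    - apply Rdiv_lt_0_compat; lra.
    - exists N. intros n m Hn Hm. specialize (HN N (le_n N)).
      rewrite Rabs_right in HN by (apply Rle_ge, pow_le; lra).
      pose proof (Hd N (n - N)%nat) as A. pose proof (Hd N (m - N)%nat) as B.
      replace (N + (n - N))%nat with n in A by lia. replace (N + (m - N))%nat with m in B by lia.
      pose proof (Cmod_sub_triangle (u n) (u N) (u m)) as D. rewrite (Cmod_sub_sym (u N)) in D.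
      assert (rho * (/ 2) ^ N < rho * (e / (2 * rho))) by (apply Rmult_lt_compat_l; lra).
      replace (rho * (e / (2 * rho))) with (e / 2) in * by (field; lra). lra. }
  destruct (Rcomplete.R_complete (fun n => fst (u n))) as [x Hx].
  { intros e He. destruct (Hsmall e He) as [N HN]. exists N. intros n m Hn Hm.
    eapply Rle_lt_trans; [exact (Cmod_fst (u n - u m))|]. auto. }
  destruct (Rcomplete.R_complete (fun n => snd (u n))) as [y Hy].
  { intros e He. destruct (Hsmall e He) as [N HN]. exists N. intros n m Hn Hm.
    eapply Rle_lt_trans; [exact (Cmod_snd (u n - u m))|]. auto. }
  pose (z := (x, y) : C).
  assert (Hz : forall e, 0 < e -> exists N, forall n, (n >= N)%nat -> Cmod (u n - z) < e).
  { intros e He.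
    destruct (Hx (e / 2)) as [N1 H1]; [lra|]. destruct (Hy (e / 2)) as [N2 H2]; [lra|].
    exists (max N1 N2). intros n Hn.
    specialize (H1 n ltac:(lia)). specialize (H2 n ltac:(lia)). unfold Rdist in *.
    replace (u n - z)%C with (RtoC (fst (u n) - x) + Ci * RtoC (snd (u n) - y))%C.
    - eapply Rle_lt_trans; [apply Cmod_triangle|]. rewrite Cmod_mult, Cmod_Ci, !Cmod_R. lra.
    - apply injective_projections; simpl; ring. }
  assert (Hzr : Cmod z <= rho).
  { apply Rnot_lt_le. intros Hc. destruct (Hz (Cmod z - rho)) as [N HN]; [lra|].
    specialize (HN N (le_n N)). specialize (Hu N).
    pose proof (Cmod_le_sub z (u N)). rewrite (Cmod_sub_sym z) in H. lra. }
  exists z. split; auto.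
  apply Cmod_sub_eq0. right. rewrite (Cmod_small_eq0 (T z - z)); [apply Cmod_0|].
  intros e He. destruct (Hz (e / 2)) as [N HN]; [lra|].
  pose proof (HN N (le_n N)). pose proof (HN (S N) (le_S _ _ (le_n N))) as B.
  change (u (S N)) with (T (u N)) in B.
  pose proof (Cmod_sub_triangle (T z) (T (u N)) z).
  pose proof (HT z (u N) Hzr (Hu N)) as D. rewrite (Cmod_sub_sym z) in D. lra.
Qed.

(** The constants are kept apart from the maps so that later estimates can be quantified over all
    pairs sharing them. The lower bound [c] gives injectivity and makes the right inverse [K]
    Lipschitz. *)
Definition good (c L r1 r2 : R) (H K : C -> C) : Prop :=
  holo r1 H /\ H 0%C = 0%C /\
  (forall z z', Cmod z < r1 -> Cmod z' < r1 ->
     c * Cmod (z - z') <= Cmod (H z - H z') <= L * Cmod (z - z')) /\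
  holo r2 K /\ (forall y, Cmod y < r2 -> Cmod (K y) < r1 /\ H (K y) = y).

(** The lower Lipschitz bound makes [K] continuous and prevents the derivative of [H] from
    vanishing; the slope of [K] is then the reciprocal of that of [H]. *)
Lemma inverse_holo c L r1 r2 H K :
  0 < c -> holo r1 H ->
  (forall z z', Cmod z < r1 -> Cmod z' < r1 ->
     c * Cmod (z - z') <= Cmod (H z - H z') <= L * Cmod (z - z')) ->
  (forall y, Cmod y < r2 -> Cmod (K y) < r1 /\ H (K y) = y) -> holo r2 K.
Proof.
  intros Hc HH Hb HK y0 Hy0.
  destruct (HK y0 Hy0) as [Hk0 Hk0'].
  destruct (HH (K y0) Hk0) as [l Hl]. apply deriv_at_slope in Hl. destruct Hl as [s [Hs [Es E]]].
  unfold idC in E.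
  assert (Hnear : forall y, Cmod (y - y0) < r2 - Cmod y0 -> Cmod y < r2).
  { intros y Hy. pose proof (Cmod_le_sub y y0). lra. }
  assert (Kc : cont_at idC K y0).
  { intros e He. unfold idC. exists (Rmin (r2 - Cmod y0) (c * e)). split.
    - apply Rmin_pos; [lra|nra].
    - intros y Hy. pose proof (Rmin_l (r2 - Cmod y0) (c * e)). pose proof (Rmin_r (r2 - Cmod y0) (c * e)).
      destruct (HK y) as [A B]; [apply Hnear; lra|].
      destruct (Hb (K y) (K y0) A Hk0) as [D _]. rewrite B, Hk0' in D. nra. }
  assert (Hl0 : l <> 0%C).
  { intros E0. destruct (Hs c Hc) as [d [Hd Hd']]. unfold idC in Hd'.
    set (t := Rmin (d / 2) ((r1 - Cmod (K y0)) / 2)).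
    assert (Ht : 0 < t) by (apply Rmin_pos; lra).
    pose proof (Rmin_l (d / 2) ((r1 - Cmod (K y0)) / 2) : t <= _).
    pose proof (Rmin_r (d / 2) ((r1 - Cmod (K y0)) / 2) : t <= _).
    assert (Ew : (K y0 + t - K y0)%C = RtoC t) by ring.
    assert (Mw : Cmod (K y0 + t - K y0) = t) by (rewrite Ew, Cmod_R, Rabs_right; lra).
    pose proof (Cmod_triangle (K y0) t) as Tr. rewrite Cmod_R, Rabs_right in Tr by lra.
    destruct (Hb (K y0 + t)%C (K y0)) as [D _]; [lra|auto|].
    specialize (Hd' (K y0 + t)%C). rewrite Es, E0 in Hd'.
    rewrite (E (K y0 + t)%C) in D.
    replace (H (K y0) + s (K y0 + t) * (K y0 + t - K y0) - H (K y0))%C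
      with (s (K y0 + t) * (K y0 + t - K y0))%C in D by ring.
    rewrite Cmod_mult, Mw in D.
    replace (s (K y0 + t) - 0)%C with (s (K y0 + t)%C) in Hd' by ring.
    specialize (Hd' ltac:(lra)). nra. }
  exists (/ l)%C.
  apply deriv_at_of_slope with (s := fun y => (/ s (K y))%C) (r := r2 - Cmod y0); [lra| | |].
  - apply cont_at_inv; [rewrite Es; auto|]. apply cont_at_comp; auto.
  - rewrite Es; auto.
  - intros y Hy. unfold idC in *. destruct (HK y (Hnear y Hy)) as [_ B].
    pose proof (E (K y)) as Ey. rewrite B, Hk0' in Ey.
    (* A vanishing slope forces [y = y0], where the value given to [/ 0] is multiplied by [0]. *)
    destruct (excluded_middle_informative (s (K y) = 0%C)) as [Z|Z].
    + assert (y = y0) by (rewrite Ey, Z; ring). subst y. ring.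
    + apply (f_equal (fun t => (t - y0)%C)) in Ey. rewrite Ey. field. auto.
Qed.

Lemma isDiff_derivative h : isDiff h -> exists l : C, l <> 0%C /\ deriv_at idC h 0%C l.
Proof.
  intros [[r [Hr Hh]] [H0 [hi [[s [Hs Hhi]] [Hi0 [[d [Hd Hid]] _]]]]]].
  apply holo_on_disc in Hh. apply holo_on_disc in Hhi.
  destruct (Hh 0%C) as [l Hl]; [rewrite Cmod_0; auto|].
  destruct (Hhi 0%C) as [m Hm]; [rewrite Cmod_0; auto|].
  exists l. split; auto. intros E. subst l.
  rewrite <- H0 in Hm. pose proof (deriv_at_comp idC h hi 0%C _ _ Hm Hl) as D.
  assert (D1 : deriv_at idC idC 0%C (m * 0)%C).
  { apply deriv_at_ext_loc with (fun y => hi (h y)) d; auto.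
    intros y Hy. apply Hid. replace y with (y - 0)%C by ring. exact Hy. }
  pose proof (deriv_at_unique _ _ _ _ D1 (deriv_at_param idC 0%C)) as E.
  replace (m * 0)%C with (RtoC 0) in E by ring. apply RtoC_inj in E. lra.
Qed.

(** A small sup norm of [phi] on the larger disc [R0] is a small Lipschitz constant on the smaller
    disc [r1], so [h + phi] stays Lipschitz-close to multiplication by [l]. *)
Lemma perturbation_good r h (l : C) :
  0 < r -> holo r h -> h 0%C = 0%C -> l <> 0%C -> deriv_at idC h 0%C l ->
  exists R0 e0 c L r1 r2, 0 < R0 <= r /\ 0 < e0 /\ 0 < c /\ 0 < L /\ 0 < r1 /\ 0 < r2 /\
    forall phi, holo R0 phi -> phi 0%C = 0%C -> (forall z, Cmod z < R0 -> Cmod (phi z) <= e0) ->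
      exists K, good c L r1 r2 (fun z => h z + phi z)%C K.
Proof.
  intros Hr Hh h0 Hl0 Hl.
  assert (Hm : 0 < Cmod l) by (apply Cmod_gt_0; auto). set (m := Cmod l) in *.
  destruct (strict_derivative r h l (m / 4) Hr Hh Hl) as [s [Hs Hs']]; [lra|].
  (* A bound [m * s / 32] on radius [s] gives [phi] the Lipschitz constant [m / 4] on radius
     [s / 4]; with the [m / 4] of [h], the sum departs from [l * z] by a map of Lipschitz constant
     [m / 2]. *)
  exists s, (m * s / 32), (m / 2), (2 * m), (s / 4), (m * s / 16).
  do 6 (split; [nra|]). intros phi Hphi phi0 Hb.
  set (H := fun z => (h z + phi z)%C).
  assert (Hchi : forall z z', Cmod z <= s / 4 -> Cmod z' <= s / 4 ->
            Cmod (H z - H z' - l * (z - z')) <= m / 2 * Cmod (z - z')).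
  { intros z z' Hz Hz'. unfold H.
    replace (h z + phi z - (h z' + phi z') - l * (z - z'))%C
      with ((h z - h z' - l * (z - z')) + (phi z - phi z'))%C by ring.
    eapply Rle_trans; [apply Cmod_triangle|].
    pose proof (Hs' z z' ltac:(lra) ltac:(lra)).
    pose proof (cauchy_lipschitz phi s (m * s / 32) z z' ltac:(lra) Hphi Hb Hz Hz') as B.
    replace (8 * (m * s / 32) / s) with (m / 4) in B by (field; lra). lra. }
  assert (Hbi : forall z z', Cmod z < s / 4 -> Cmod z' < s / 4 ->
     m / 2 * Cmod (z - z') <= Cmod (H z - H z') <= 2 * m * Cmod (z - z')).
  { intros z z' Hz Hz'. specialize (Hchi z z' ltac:(lra) ltac:(lra)).
    pose proof (Cmod_le_sub (H z - H z') (l * (z - z'))) as A.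
    pose proof (Cmod_le_sub (l * (z - z')) (H z - H z')) as B.
    rewrite (Cmod_sub_sym (l * (z - z'))) in B. rewrite !Cmod_mult in *. fold m in A, B.
    pose proof (Cmod_ge_0 (z - z')). split; nra. }
  assert (HH : holo (s / 4) H).
  { apply holo_plus; [apply holo_mono with r|apply holo_mono with s]; auto; lra. }
  assert (H0 : H 0%C = 0%C) by (unfold H; rewrite h0, phi0; ring).
  assert (Hsol : forall y, exists x, Cmod y < m * s / 16 -> Cmod x < s / 4 /\ H x = y).
  { intros y. destruct (Rlt_dec (Cmod y) (m * s / 16)) as [Hy|]; [|exists 0%C; tauto].
    (* Newton's iteration with the derivative frozen at [l]. The bound [m * s / 16] on [y] puts the
       first iterate [y / l] within half the radius [s / 8]. *)
    destruct (contraction_fixpoint (fun z => z + (y - H z) / l)%C (s / 8)) as [x [Hx Ex]].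
    - lra.
    - intros z z' Hz Hz'.
      replace (z + (y - H z) / l - (z' + (y - H z') / l))%C
        with ((- (H z - H z' - l * (z - z'))) / l)%C by (field; auto).
      rewrite Cmod_div, Cmod_opp by auto. fold m.
      specialize (Hchi z z' ltac:(lra) ltac:(lra)).
      apply Rmult_le_reg_r with m; auto. unfold Rdiv. rewrite Rmult_assoc, Rinv_l by lra. lra.
    - rewrite H0. replace (0 + (y - 0) / l)%C with (y / l)%C by (field; auto).
      rewrite Cmod_div by auto. fold m. apply Rmult_le_reg_r with m; auto.
      unfold Rdiv at 1. rewrite Rmult_assoc, Rinv_l by lra. nra.
    - exists x. intros _. split; [lra|].
      assert (E : (y - H x)%C = 0%C).
      { replace (y - H x)%C with ((x + (y - H x) / l - x) * l)%C by (field; auto). rewrite Ex. ring. }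
      replace (H x) with (y - (y - H x))%C by ring. rewrite E. ring. }
  exists (fun y => proj1_sig (constructive_indefinite_description _ (Hsol y))).
  assert (HK : forall y, Cmod y < m * s / 16 ->
    Cmod (proj1_sig (constructive_indefinite_description _ (Hsol y))) < s / 4 /\
    H (proj1_sig (constructive_indefinite_description _ (Hsol y))) = y).
  { intros y Hy. destruct (constructive_indefinite_description _ (Hsol y)) as [x Hx]. simpl; auto. }
  repeat split; auto.
  - apply Hbi; auto.
  - apply Hbi; auto.
  - apply (inverse_holo (m / 2) (2 * m) (s / 4) (m * s / 16) H); auto. lra.
  - apply HK; auto.
  - apply HK; auto.
Qed.

(** * Periodic germs *)

(** Invertibility is left out so that differences and sums of germs are included. *)
Definition germ0 (F : C -> C) : Prop := F 0%C = 0%C /\ exists r, 0 < r /\ holo r F.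

Lemma germ0_isDiff f : isDiff f -> germ0 f.
Proof.
  intros [[r [Hr Hh]] [H0 _]]. split; auto. exists r. split; auto. apply holo_on_disc; auto.
Qed.

Lemma germ0_inv f fi : germ_inv f fi -> germ0 fi.
Proof.
  intros [[r [Hr Hh]] [H0 _]]. split; auto. exists r. split; auto. apply holo_on_disc; auto.
Qed.

Lemma germ0_small F e : germ0 F -> 0 < e -> exists d, 0 < d /\ forall z, Cmod z < d -> Cmod (F z) < e.
Proof.
  intros [H0 [r [Hr HF]]] He.
  destruct (holo_cont r F 0%C HF ltac:(rewrite Cmod_0; auto) e He) as [d [Hd Hd']].
  exists d; split; auto. intros z Hz. specialize (Hd' z). unfold idC in Hd'.
  rewrite H0 in Hd'. replace (z - 0)%C with z in Hd' by ring.
  replace (F z - 0)%C with (F z) in Hd' by ring. auto.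
Qed.

Lemma germ0_id : germ0 (fun z => z).
Proof. split; auto. exists 1. split; [lra|apply holo_id]. Qed.

Lemma germ0_comp F G : germ0 F -> germ0 G -> germ0 (fun z => F (G z)).
Proof.
  intros HF HG. destruct HF as [F0 [r [Hr HF]]].
  destruct (germ0_small G r HG Hr) as [d [Hd Hd']]. destruct HG as [G0 [s [Hs HG]]].
  split; [rewrite G0; auto|]. exists (Rmin d s). split; [apply Rmin_pos; auto|].
  apply holo_comp with r; auto.
  - apply holo_mono with s; auto. apply Rmin_r.
  - intros z Hz. apply Hd'. pose proof (Rmin_l d s). lra.
Qed.

Lemma germ0_iter F n : germ0 F -> germ0 (iter n F).
Proof.
  intros HF. induction n; simpl; [apply germ0_id|]. apply (germ0_comp F (iter n F)); auto.
Qed.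

Lemma germ0_lipschitz F : germ0 F -> exists r Q, 0 < r /\ 1 <= Q /\ holo r F /\
  forall z z', Cmod z < r -> Cmod z' < r -> Cmod (F z - F z') <= Q * Cmod (z - z').
Proof.
  intros [F0 [r [Hr HF]]]. destruct (HF 0%C) as [l Hl]; [rewrite Cmod_0; auto|].
  destruct (strict_derivative r F l 1 Hr HF Hl) as [s [Hs Hs']]; [lra|].
  exists s, (1 + Cmod l). pose proof (Cmod_ge_0 l). repeat split; try lra.
  - apply holo_mono with r; auto; lra.
  - intros z z' Hz Hz'. specialize (Hs' z z' Hz Hz').
    pose proof (Cmod_le_sub (F z - F z') (l * (z - z'))) as A. rewrite Cmod_mult in A. lra.
Qed.

Lemma iter_add m n f z : iter (m + n) f z = iter m f (iter n f z).
Proof. induction m; simpl; congruence. Qed.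

Lemma iter_mul m n f z : iter (m * n) f z = iter m (iter n f) z.
Proof. induction m; simpl; auto. rewrite iter_add. congruence. Qed.

Lemma iter_fixed n f z : f z = z -> iter n f z = z.
Proof. intros H. induction n; simpl; congruence. Qed.

(** Up to the factor [1 / n], the averaged coordinate that linearizes a germ of period [n] tangent
    to the identity. *)
Fixpoint orbit_sum (n : nat) (G : C -> C) (z : C) : C :=
  match n with O => 0%C | S m => (orbit_sum m G z + iter m G z)%C end.

Lemma orbit_sum_shift n G z : (orbit_sum n G (G z) + z = orbit_sum n G z + iter n G z)%C.
Proof.
  assert (E : forall m, iter m G (G z) = iter (S m) G z).
  { intros m. rewrite <- (Nat.add_1_r m), iter_add. reflexivity. }
  induction n; [simpl; ring|]. simpl orbit_sum. rewrite E.
  replace (orbit_sum n G (G z) + iter (S n) G z + z)%C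
    with ((orbit_sum n G (G z) + z) + iter (S n) G z)%C by ring.
  rewrite IHn. ring.
Qed.

Lemma orbit_sum_germ n G : germ0 G -> deriv_at idC G 0%C 1%C ->
  germ0 (orbit_sum n G) /\ deriv_at idC (orbit_sum n G) 0%C (RtoC (INR n)).
Proof.
  intros HG HG1.
  assert (Hi : forall n, deriv_at idC (iter n G) 0%C 1%C).
  { induction n0 as [|m IH].
    - simpl. apply (deriv_at_param idC).
    - simpl. replace (RtoC 1) with (RtoC 1 * RtoC 1)%C by ring.
      apply (deriv_at_comp idC (iter m G)); auto.
      destruct (germ0_iter G m HG) as [-> _]. auto. }
  induction n as [|n [IH1 IH2]].
  - split; [split; auto; exists 1; split; [lra|apply holo_const]|apply (deriv_at_const idC)].
  - split.
    + destruct IH1 as [A [r [Hr HA]]]. destruct (germ0_iter G n HG) as [B [s [Hs HB]]].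
      split; [simpl; rewrite A, B; ring|]. exists (Rmin r s). split; [apply Rmin_pos; auto|].
      apply holo_plus; [apply holo_mono with r|apply holo_mono with s]; auto; [apply Rmin_l|apply Rmin_r].
    + rewrite S_INR, RtoC_plus. simpl. apply deriv_at_plus; auto.
Qed.

Lemma germ0_injective F (l : C) : germ0 F -> deriv_at idC F 0%C l -> l <> 0%C ->
  exists r, 0 < r /\ forall z z', Cmod z < r -> Cmod z' < r -> F z = F z' -> z = z'.
Proof.
  intros [F0 [r [Hr HF]]] Hl Hl0. assert (Hm : 0 < Cmod l) by (apply Cmod_gt_0; auto).
  destruct (strict_derivative r F l (Cmod l / 2) Hr HF Hl) as [s [Hs Hs']]; [lra|].
  exists s. split; [lra|]. intros z z' Hz Hz' E. specialize (Hs' z z' Hz Hz').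
  rewrite E in Hs'. replace (F z' - F z' - l * (z - z'))%C with (- (l * (z - z')))%C in Hs' by ring.
  rewrite Cmod_opp, Cmod_mult in Hs'. apply Cmod_sub_eq0. nra.
Qed.

(* If [G' 0 <> 1] then [G - id] is injective near [0]; if [G' 0 = 1] then the sum of
   the iterates of [G] is injective near [0] and invariant under [G], so [G] is the identity. *)
Lemma periodic_fixed_points G n :
  germ0 G -> (0 < n)%nat -> germ_id (iter n G) -> ~ germ_id G ->
  exists r, 0 < r /\ forall z, Cmod z < r -> G z = z -> z = 0%C.
Proof.
  intros HG Hn [d [Hd Hid]] Hni.
  pose proof HG as [G0 [r [Hr HGr]]]. destruct (HGr 0%C) as [l Hl]; [rewrite Cmod_0; auto|].
  destruct (excluded_middle_informative (l = 1%C)) as [->|Hl1].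
  - destruct (orbit_sum_germ n G HG Hl) as [HP HP'].
    destruct (germ0_injective _ _ HP HP') as [s [Hs Hs']].
    { intros E. apply RtoC_inj in E. apply lt_0_INR in Hn. lra. }
    exfalso. apply Hni. destruct (germ0_small G s HG Hs) as [e [He He']].
    exists (Rmin d (Rmin s e)). split; [repeat apply Rmin_pos; auto|]. intros z Hz.
    pose proof (Rmin_l d (Rmin s e)). pose proof (Rmin_r d (Rmin s e)).
    pose proof (Rmin_l s e). pose proof (Rmin_r s e).
    apply Hs'; [apply He'; lra|lra|].
    pose proof (orbit_sum_shift n G z) as E. rewrite Hid in E by lra.
    apply (f_equal (fun w => (w - z)%C)) in E.
    replace (orbit_sum n G (G z)) with (orbit_sum n G (G z) + z - z)%C by ring. rewrite E. ring.
  - assert (HD : germ0 (fun z => G z + (- (1)) * z)%C).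
    { split; [rewrite G0; ring|]. exists r. split; auto.
      apply holo_plus; auto. apply holo_mult; [apply holo_const|apply holo_id]. }
    destruct (germ0_injective (fun z => G z + (- (1)) * z)%C (l + (- (1)))%C HD) as [s [Hs Hs']].
    + eapply deriv_at_ext;
        [| |apply deriv_at_plus; [exact Hl|
            apply deriv_at_mult; [apply (deriv_at_const idC (- (1))%C)|apply (deriv_at_param idC)]]].
      * intros; reflexivity.
      * simpl; ring.
    + intros E. apply Hl1. replace l with (l + - (1) + 1)%C by ring. rewrite E. ring.
    + exists s. split; auto. intros z Hz Ez. apply Hs'; auto; [rewrite Cmod_0; auto|].
      rewrite Ez, G0. ring.
Qed.

Lemma uniform_radius (P : nat -> R -> Prop) N :
  (forall n r s, 0 < s <= r -> P n r -> P n s) ->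
  (forall n, (n <= N)%nat -> exists r, 0 < r /\ P n r) ->
  exists r, 0 < r /\ forall n, (n <= N)%nat -> P n r.
Proof.
  intros Hm. induction N; intros HP.
  - destruct (HP 0%nat (le_n _)) as [r [Hr Hr']]. exists r. split; auto.
    intros n Hn. replace n with 0%nat by lia. auto.
  - destruct IHN as [r [Hr Hr']]; [intros; apply HP; lia|].
    destruct (HP (S N) (le_n _)) as [s [Hs Hs']].
    exists (Rmin r s). pose proof (Rmin_pos r s Hr Hs). split; auto. intros n Hn.
    destruct (Nat.eq_dec n (S N)) as [->|].
    + apply Hm with s; auto. split; auto. apply Rmin_r.
    + apply Hm with r; [split; auto; apply Rmin_l|]. apply Hr'. lia.
Qed.

Definition periodic_on (f : C -> C) (k : nat) (r Q : R) : Prop :=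
  f 0%C = 0%C /\
  (forall n, (n <= k)%nat -> holo r (iter n f) /\
     (forall z z', Cmod z < r -> Cmod z' < r -> Cmod (iter n f z - iter n f z') <= Q * Cmod (z - z')) /\
     ((0 < n < k)%nat -> forall z, Cmod z < r -> iter n f z = z -> z = 0%C)) /\
  (forall z, Cmod z < r -> iter k f z = z).

(** For [0 < n < k] the power [iter n f] is itself periodic and, by minimality of [k], not the
    identity germ, so [periodic_fixed_points] applies to each of them. *)
Lemma periodic_on_exists f k : isDiff f -> has_period f k ->
  exists r Q, 0 < r /\ 1 <= Q /\ periodic_on f k r Q.
Proof.
  intros Hf (Hk & [d [Hd Hid]] & Hmin). apply germ0_isDiff in Hf.
  (* A common constant [Q] is found while each iterate keeps its own radius; [uniform_radius] can
     then shrink the radii with [Q] fixed. *)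
  assert (HQ : forall N, exists Q, 1 <= Q /\ forall n, (n <= N)%nat ->
    exists r, 0 < r /\ holo r (iter n f) /\
      forall z z', Cmod z < r -> Cmod z' < r -> Cmod (iter n f z - iter n f z') <= Q * Cmod (z - z')).
  { induction N as [|N [Q' [HQ' IH]]].
    - destruct (germ0_lipschitz _ (germ0_iter f 0 Hf)) as [r [Q [Hr [HQ [HH HL]]]]].
      exists Q. split; auto. intros n Hn. replace n with 0%nat by lia. exists r; auto.
    - destruct (germ0_lipschitz _ (germ0_iter f (S N) Hf)) as [r [Q [Hr [HQ [HH HL]]]]].
      exists (Rmax Q Q'). pose proof (Rmax_l Q Q'). pose proof (Rmax_r Q Q'). split; [lra|].
      intros n Hn. destruct (Nat.eq_dec n (S N)) as [->|].
      + exists r; repeat split; auto. intros z z' Hz Hz'. pose proof (Cmod_ge_0 (z - z')).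
        specialize (HL z z' Hz Hz'). nra.
      + destruct (IH n ltac:(lia)) as [r' [Hr' [HH' HL']]]. exists r'; repeat split; auto.
        intros z z' Hz Hz'. pose proof (Cmod_ge_0 (z - z')). specialize (HL' z z' Hz Hz'). nra. }
  specialize (HQ k).
  destruct HQ as [Q [HQ1 HQ]].
  destruct (uniform_radius (fun n r => r <= d /\ holo r (iter n f) /\
     (forall z z', Cmod z < r -> Cmod z' < r -> Cmod (iter n f z - iter n f z') <= Q * Cmod (z - z')) /\
     ((0 < n < k)%nat -> forall z, Cmod z < r -> iter n f z = z -> z = 0%C)) k) as [r [Hr HP]].
  - intros n r s Hs (A & B & D & E). repeat split; [lra|apply holo_mono with r; auto; lra| |].
    + intros; apply D; lra.
    + intros Hn z Hz. apply E; auto; lra.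
  - intros n Hn. destruct (HQ n Hn) as [r [Hr [HH HL]]].
    destruct (classic (0 < n < k)%nat) as [Hnk|Hnk].
    + destruct (periodic_fixed_points (iter n f) k) as [s [Hs Hs']].
      * apply germ0_iter; auto.
      * lia.
      * exists d. split; auto. intros z Hz. rewrite <- iter_mul, Nat.mul_comm, iter_mul.
        apply iter_fixed. apply Hid; auto.
      * apply Hmin; lia.
      * exists (Rmin d (Rmin r s)).
        pose proof (Rmin_l d (Rmin r s)). pose proof (Rmin_r d (Rmin r s)).
        pose proof (Rmin_l r s). pose proof (Rmin_r r s).
        split; [repeat apply Rmin_pos; auto|]. repeat split; [lra|apply holo_mono with r; auto; lra| |].
        -- intros; apply HL; lra.
        -- intros _ z Hz. apply Hs'. lra.
    + exists (Rmin d r). pose proof (Rmin_l d r). pose proof (Rmin_r d r).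
      split; [apply Rmin_pos; auto|]. repeat split; [lra|apply holo_mono with r; auto; lra| |tauto].
      intros; apply HL; lra.
  - exists r, Q. repeat split; auto; try (apply HP; auto; fail).
    + destruct Hf; auto.
    + intros z Hz. apply Hid. destruct (HP 0%nat ltac:(lia)). lra.
Qed.

(** * Words and their evaluation *)

(** Exponents are natural numbers because [a] and [b] have finite order: an inverse letter is a
    positive power. *)
Definition syllable := (bool * nat)%type.

Fixpoint spell (s : list syllable) : word :=
  match s with nil => nil | (b, n) :: t => repeat (b, true) n ++ spell t end.

Fixpoint reduced (k l : nat) (s : list syllable) : Prop :=
  match s with
  | nil => True
  | (b, n) :: t => (0 < n < if b then k else l)%nat /\
      match t with nil => True | (b', _) :: _ => b' <> b end /\ reduced k l t
  end.

Lemma pres_eq_app_l k l p u v : pres_eq k l u v -> pres_eq k l (p ++ u) (p ++ v).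
Proof.
  induction 1.
  - apply pres_refl.
  - apply pres_sym; auto.
  - eapply pres_trans; eauto.
  - rewrite !(app_assoc p). apply pres_cancel.
  - rewrite !(app_assoc p). apply pres_rel_a.
  - rewrite !(app_assoc p). apply pres_rel_b.
Qed.

Lemma pres_eq_rel k l (b : bool) u v :
  pres_eq k l (u ++ repeat (b, true) (if b then k else l) ++ v) (u ++ v).
Proof. destruct b; [apply pres_rel_a|apply pres_rel_b]. Qed.

(** A letter either opens a new syllable or merges with the first one; a merged syllable that
    reaches the full period is a relator and disappears. *)
Lemma spell_mult_pos k l (b : bool) s : (0 < k)%nat -> (0 < l)%nat -> reduced k l s ->
  exists s', reduced k l s' /\ pres_eq k l ((b, true) :: spell s) (spell s').
Proof.
  intros Hk Hl Hs. set (K := if b then k else l).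
  assert (HK : (0 < K)%nat) by (unfold K; destruct b; auto).
  assert (Hnew : match s with nil => True | (b', _) :: _ => b' <> b end ->
    exists s', reduced k l s' /\ pres_eq k l ((b, true) :: spell s) (spell s')).
  (* When the period is [1] the letter is itself a relator, and opening a syllable would violate
     [0 < n < K]. *)
  { intros Hb. destruct (Nat.eq_dec K 1) as [E|E].
    - exists s. split; auto. pose proof (pres_eq_rel k l b nil (spell s)) as P.
      fold K in P. rewrite E in P. exact P.
    - exists ((b, 1%nat) :: s). split; [|apply pres_refl].
      simpl. fold K. repeat split; auto; lia. }
  destruct s as [|[b' n] t]; [apply Hnew; auto|].
  destruct (Bool.bool_dec b' b) as [->|Hb]; [|apply Hnew; auto].
  destruct Hs as (Hn & Ht & Hr). fold K in Hn.
  destruct (Nat.eq_dec (S n) K) as [E|E].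
  - exists t. split; auto.
    change ((b, true) :: spell ((b, n) :: t)) with (repeat (b, true) (S n) ++ spell t).
    rewrite E. apply (pres_eq_rel k l b nil).
  - exists ((b, S n) :: t). split; [|apply pres_refl]. simpl. fold K. repeat split; auto; lia.
Qed.

Lemma spell_mult_pow k l b m s : (0 < k)%nat -> (0 < l)%nat -> reduced k l s ->
  exists s', reduced k l s' /\ pres_eq k l (repeat (b, true) m ++ spell s) (spell s').
Proof.
  intros Hk Hl Hs. induction m as [|m [s1 [H1 E1]]].
  - exists s. split; auto. apply pres_refl.
  - destruct (spell_mult_pos k l b s1 Hk Hl H1) as [s2 [H2 E2]].
    exists s2. split; auto. eapply pres_trans; [|exact E2].
    apply (pres_eq_app_l k l [(b, true)]). exact E1.
Qed.

(** A relator is inserted after the inverse letter, which then cancels its first letter. *)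
Lemma pres_eq_inverse_letter k l (b : bool) w : (0 < k)%nat -> (0 < l)%nat ->
  pres_eq k l ((b, false) :: w) (repeat (b, true) (pred (if b then k else l)) ++ w).
Proof.
  intros Hk Hl.
  eapply pres_trans; [apply pres_sym; apply (pres_eq_rel k l b [(b, false)] w)|].
  set (K := if b then k else l). assert (HK : K = S (pred K)) by (unfold K; destruct b; lia).
  rewrite HK at 1. simpl. apply (pres_cancel k l nil _ (b, false)).
Qed.

(** A word that is nontrivial in the presented group thereby yields a nonempty reduced list; that
    such a list moves some point is left to the dynamics. *)
Lemma normal_form k l w : (0 < k)%nat -> (0 < l)%nat ->
  exists s, reduced k l s /\ pres_eq k l w (spell s).
Proof.
  intros Hk Hl. induction w as [|[b e] w [s [Hs E]]].
  - exists nil. split; [exact I|apply pres_refl].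
  - assert (H : exists m, pres_eq k l ((b, e) :: w) (repeat (b, true) m ++ w)).
    { destruct e; [exists 1%nat; apply pres_refl|].
      eexists. apply pres_eq_inverse_letter; auto. }
    destruct H as [m Hm]. destruct (spell_mult_pow k l b m s Hk Hl Hs) as [s' [Hs' E']].
    exists s'. split; auto. eapply pres_trans; [exact Hm|]. eapply pres_trans; [|exact E'].
    apply pres_eq_app_l. exact E.
Qed.

(** * Evaluation of words as germs *)

Lemma germ_eq_refl u : germ_eq u u.
Proof. exists 1. split; [lra|auto]. Qed.

Lemma germ_eq_sym u v : germ_eq u v -> germ_eq v u.
Proof. intros [r [Hr H]]. exists r. split; auto. intros; symmetry; auto. Qed.

Lemma germ_eq_trans u v w : germ_eq u v -> germ_eq v w -> germ_eq u w.
Proof.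
  intros [r [Hr H]] [s [Hs H']]. exists (Rmin r s). split; [apply Rmin_pos; auto|].
  intros z Hz. pose proof (Rmin_l r s). pose proof (Rmin_r r s).
  rewrite H, H' by lra. auto.
Qed.

Lemma germ_eq_ext u v : (forall z, u z = v z) -> germ_eq u v.
Proof. intros H. exists 1. split; [lra|auto]. Qed.

Lemma germ_eq_comp u u' v v' :
  germ_eq u u' -> germ_eq v v' -> germ0 v -> germ_eq (fun z => u (v z)) (fun z => u' (v' z)).
Proof.
  intros [r [Hr H]] [s [Hs H']] Hv. destruct (germ0_small v r Hv Hr) as [d [Hd Hd']].
  exists (Rmin s d). split; [apply Rmin_pos; auto|].
  intros z Hz. pose proof (Rmin_l s d). pose proof (Rmin_r s d).
  rewrite <- H' by lra. apply H, Hd'. lra.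
Qed.

Lemma eval_word_germ0 A Ai B Bi w :
  germ0 A -> germ0 Ai -> germ0 B -> germ0 Bi -> germ0 (eval_word A Ai B Bi w).
Proof.
  intros HA HAi HB HBi. induction w as [|[[] []] w IH]; [apply germ0_id|..]; simpl.
  - apply (germ0_comp A (eval_word A Ai B Bi w)); auto.
  - apply (germ0_comp Ai (eval_word A Ai B Bi w)); auto.
  - apply (germ0_comp B (eval_word A Ai B Bi w)); auto.
  - apply (germ0_comp Bi (eval_word A Ai B Bi w)); auto.
Qed.

Lemma eval_word_app A Ai B Bi u v z :
  eval_word A Ai B Bi (u ++ v) z = eval_word A Ai B Bi u (eval_word A Ai B Bi v z).
Proof. induction u as [|x u IH]; simpl; auto. rewrite IH. auto. Qed.

Lemma eval_word_repeat A Ai B Bi (b : bool) n z :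
  eval_word A Ai B Bi (repeat (b, true) n) z = iter n (if b then A else B) z.
Proof. induction n; simpl; auto. rewrite IHn. destruct b; auto. Qed.

Lemma eval_word_context A Ai B Bi u x y v :
  germ0 A -> germ0 Ai -> germ0 B -> germ0 Bi ->
  germ_eq (eval_word A Ai B Bi x) (eval_word A Ai B Bi y) ->
  germ_eq (eval_word A Ai B Bi (u ++ x ++ v)) (eval_word A Ai B Bi (u ++ y ++ v)).
Proof.
  intros HA HAi HB HBi H. set (ev := eval_word A Ai B Bi) in *.
  assert (Hev : forall w, germ0 (ev w)) by (intros; apply eval_word_germ0; auto).
  apply germ_eq_trans with (fun z => ev u (ev x (ev v z)));
    [apply germ_eq_ext; intros; unfold ev; rewrite !eval_word_app; auto|].
  apply germ_eq_trans with (fun z => ev u (ev y (ev v z)));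
    [|apply germ_eq_ext; intros; unfold ev; rewrite !eval_word_app; auto].
  apply (germ_eq_comp (ev u) (ev u) (fun z => ev x (ev v z)) (fun z => ev y (ev v z))).
  - apply germ_eq_refl.
  - apply germ_eq_comp; auto using germ_eq_refl.
  - apply germ0_comp; auto.
Qed.

Lemma eval_word_sound A Ai B Bi k l u v :
  germ0 A -> germ0 Ai -> germ0 B -> germ0 Bi ->
  germ_id (fun z => A (Ai z)) -> germ_id (fun z => Ai (A z)) ->
  germ_id (fun z => B (Bi z)) -> germ_id (fun z => Bi (B z)) ->
  germ_id (iter k A) -> germ_id (iter l B) ->
  pres_eq k l u v -> germ_eq (eval_word A Ai B Bi u) (eval_word A Ai B Bi v).
Proof.
  intros HA HAi HB HBi E1 E2 E3 E4 Ek El H. induction H.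
  - apply germ_eq_refl.
  - apply germ_eq_sym; auto.
  - eapply germ_eq_trans; eauto.
  - apply (eval_word_context A Ai B Bi u [x; linv x] nil v); auto.
    destruct x as [[] []]; simpl; assumption.
  - apply (eval_word_context A Ai B Bi u _ nil v); auto.
    apply germ_eq_trans with (iter k A); [|exact Ek].
    apply germ_eq_ext. apply (eval_word_repeat A Ai B Bi true).
  - apply (eval_word_context A Ai B Bi u _ nil v); auto.
    apply germ_eq_trans with (iter l B); [|exact El].
    apply germ_eq_ext. apply (eval_word_repeat A Ai B Bi false).
Qed.

Lemma iter_conjugate g h hi n : germ0 g -> germ0 h -> germ0 hi -> germ_id (fun z => h (hi z)) ->
  germ_id (fun z => hi (h z)) -> germ_eq (iter n (fun z => hi (g (h z)))) (fun z => hi (iter n g (h z))).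
Proof.
  intros Hg Hh Hhi E1 E2. induction n as [|n IH]; simpl; [apply germ_eq_sym; exact E2|].
  assert (Hgn : germ0 (fun z => iter n g (h z))) by (apply germ0_comp; auto; apply germ0_iter; auto).
  assert (Hc : germ0 (fun z => hi (g (h z)))).
  { apply (germ0_comp hi (fun z => g (h z))); auto. apply germ0_comp; auto. }
  apply germ_eq_trans with (fun z => hi (g (h (hi (iter n g (h z)))))).
  - apply (germ_eq_comp (fun z => hi (g (h z))) (fun z => hi (g (h z)))); auto using germ_eq_refl.
    apply germ0_iter; auto.
  - apply (germ_eq_comp (fun z => hi (g z)) (fun z => hi (g z)) (fun z => h (hi (iter n g (h z))))
             (fun z => iter n g (h z))); auto using germ_eq_refl.
    + apply (germ_eq_comp (fun z => h (hi z)) (fun z => z)); auto using germ_eq_refl.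
    + apply (germ0_comp (fun z => h (hi z)) (fun z => iter n g (h z))); auto. apply germ0_comp; auto.
Qed.

(** Each [b]-syllable is one conjugated power, so [H] and [K] enter once per syllable instead of
    once per letter. *)
Fixpoint syl_eval (f g H K : C -> C) (s : list syllable) (z : C) : C :=
  match s with
  | nil => z
  | (true, n) :: t => iter n f (syl_eval f g H K t z)
  | (false, n) :: t => K (iter n g (H (syl_eval f g H K t z)))
  end.

(** A left inverse and a right inverse of the same germ coincide: both equal [hi (H (K y))]. *)
Lemma germ_inv_unique h hi H K : germ_inv h hi -> germ_eq h H -> germ0 K ->
  germ_id (fun y => H (K y)) -> germ_eq hi K.
Proof.
  intros (Hhi & _ & Hl & _) E HK HHK.
  apply germ_eq_trans with (fun y => hi (H (K y))).
  - destruct HHK as [r [Hr HHK]]. exists r. split; auto. intros z Hz. rewrite HHK; auto.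
  - destruct E as [s [Hs E]]. destruct Hl as [d [Hd Hl]].
    destruct (germ0_small K (Rmin s d) HK) as [e [He He']]; [apply Rmin_pos; auto|].
    pose proof (Rmin_l s d). pose proof (Rmin_r s d).
    exists e. split; auto. intros z Hz. specialize (He' z Hz). rewrite <- E by lra. apply Hl. lra.
Qed.

Lemma eval_spell f fi g gi h hi H K s : germ0 f -> germ0 g -> germ0 fi -> germ0 gi ->
  germ0 h -> germ0 H -> germ0 K -> germ_inv h hi -> germ_eq h H -> germ_id (fun y => H (K y)) ->
  germ_eq (eval_word f fi (fun z => hi (g (h z))) (fun z => hi (gi (h z))) (spell s))
          (syl_eval f g H K s).
Proof.
  intros Hf Hg Hfi Hgi Hh HH HK Hinv E HHK.
  assert (Hhi := germ0_inv _ _ Hinv).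
  assert (EK := germ_inv_unique h hi H K Hinv E HK HHK).
  destruct Hinv as (_ & _ & L1 & L2).
  assert (Hc : forall p, germ0 p -> germ0 (fun z => hi (p (h z)))).
  { intros p Hp. apply (germ0_comp hi (fun z => p (h z))); auto. apply germ0_comp; auto. }
  set (ev := eval_word f fi (fun z => hi (g (h z))) (fun z => hi (gi (h z)))).
  assert (Hev : forall w, germ0 (ev w)) by (intros; apply eval_word_germ0; auto).
  induction s as [|[b n] t IH]; [apply germ_eq_refl|].
  apply germ_eq_trans with (fun z => iter n (if b then f else (fun z => hi (g (h z)))) (ev (spell t) z)).
  { apply germ_eq_ext. intros z. simpl spell. unfold ev.
    rewrite eval_word_app, eval_word_repeat. reflexivity. }
  destruct b; simpl.
  - apply germ_eq_comp; auto using germ_eq_refl.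
  - apply germ_eq_trans with (fun z => hi (iter n g (h (ev (spell t) z)))).
    + apply (germ_eq_comp _ (fun z => hi (iter n g (h z))) (ev (spell t)) (ev (spell t)));
        auto using germ_eq_refl, iter_conjugate.
    + apply (germ_eq_comp hi K (fun z => iter n g (h (ev (spell t) z)))
               (fun z => iter n g (H (syl_eval f g H K t z)))); auto.
      * apply (germ_eq_comp (iter n g) (iter n g) (fun z => h (ev (spell t) z))); auto using germ_eq_refl.
        -- apply germ_eq_comp; auto.
        -- apply germ0_comp; auto.
      * apply (germ0_comp (iter n g) (fun z => h (ev (spell t) z))); auto using germ0_iter.
        apply germ0_comp; auto.
Qed.

(** * Uniform domains for reduced words *)

Lemma periodic_on_mono f k r Q r' Q' :
  0 < r' <= r -> Q <= Q' -> periodic_on f k r Q -> periodic_on f k r' Q'.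
Proof.
  intros Hr HQ (H0 & H1 & H2). split; [auto|split].
  - intros n Hn. destruct (H1 n Hn) as (A & B & D). repeat split.
    + apply holo_mono with r; auto; lra.
    + intros z z' Hz Hz'. specialize (B z z' ltac:(lra) ltac:(lra)).
      pose proof (Cmod_ge_0 (z - z')). nra.
    + intros Hnk z Hz. apply D; auto; lra.
  - intros z Hz. apply H2. lra.
Qed.

Lemma periodic_on_bound f k r Q n z :
  periodic_on f k r Q -> (n <= k)%nat -> Cmod z < r -> Cmod (iter n f z) <= Q * Cmod z.
Proof.
  intros (H0 & H1 & _) Hn Hz. destruct (H1 n Hn) as (_ & A & _).
  specialize (A z 0%C Hz). rewrite (iter_fixed n f 0%C H0), Cmod_0 in A.
  replace (iter n f z - 0)%C with (iter n f z) in A by ring. replace (z - 0)%C with z in A by ring.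
  apply A. pose proof (Cmod_ge_0 z). lra.
Qed.

Lemma good_bound c L r1 r2 H K z :
  good c L r1 r2 H K -> Cmod z < r1 -> c * Cmod z <= Cmod (H z) <= L * Cmod z.
Proof.
  intros (_ & H0 & Hb & _) Hz. pose proof (Cmod_ge_0 z).
  specialize (Hb z 0%C Hz). rewrite H0, Cmod_0 in Hb.
  replace (z - 0)%C with z in Hb by ring. replace (H z - 0)%C with (H z) in Hb by ring.
  apply Hb. lra.
Qed.

Definition syl_step (f g H K : C -> C) (b : bool) (n : nat) (z : C) : C :=
  if b then iter n f z else K (iter n g (H z)).

Lemma syl_eval_cons f g H K b n t z :
  syl_eval f g H K ((b, n) :: t) z = syl_step f g H K b n (syl_eval f g H K t z).
Proof. destruct b; reflexivity. Qed.

(* Domain [rho] and growth constant [P] for one syllable, uniform over all [H] that are [good] with the given constants. *)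
Definition controlled (f g : C -> C) (k l : nat) (r c L r1 r2 rho P : R) : Prop :=
  0 < rho /\ rho <= r /\ rho <= r1 /\ 1 <= P /\
  (forall H K, good c L r1 r2 H K ->
     (forall z, Cmod z < rho -> Cmod (H z) < r /\ forall n, (n <= l)%nat -> Cmod (iter n g (H z)) < r2) /\
     (forall (b : bool) n, (n <= if b then k else l)%nat -> holo rho (syl_step f g H K b n) /\
        forall z, Cmod z < rho -> Cmod (syl_step f g H K b n z) <= P * Cmod z)) /\
  (forall H K H' K' eta, good c L r1 r2 H K -> good c L r1 r2 H' K' ->
     (forall z, Cmod z < r1 -> Cmod (H z - H' z) <= eta) ->
     forall (b : bool) n, (n <= if b then k else l)%nat ->
     forall x x', Cmod x < rho -> Cmod x' < rho ->
       Cmod (syl_step f g H K b n x - syl_step f g H' K' b n x') <= P * (Cmod (x - x') + eta)).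

Lemma controlled_exists f g k l r Q c L r1 r2 :
  0 < r -> 1 <= Q -> 0 < c -> 0 < L -> 0 < r1 -> 0 < r2 ->
  periodic_on f k r Q -> periodic_on g l r Q ->
  exists rho P, controlled f g k l r c L r1 r2 rho P.
Proof.
  intros Hr HQ Hc HL H1 H2 Hf Hg.
  assert (Q1 : 0 < Q * L) by nra.
  (* The bound [r / L] sends [H z] into the disc where [g] is controlled, and [r2 / (Q * L)] sends
     its iterates into the domain of [K]. *)
  set (rho := Rmin (Rmin r r1) (Rmin (r / L) (r2 / (Q * L)))).
  assert (Hrho : 0 < rho) by (repeat apply Rmin_pos; auto; apply Rdiv_lt_0_compat; lra).
  assert (B1 : rho <= r) by (eapply Rle_trans; [apply Rmin_l|apply Rmin_l]).
  assert (B2 : rho <= r1) by (eapply Rle_trans; [apply Rmin_l|apply Rmin_r]).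
  assert (B3 : rho <= r / L) by (eapply Rle_trans; [apply Rmin_r|apply Rmin_l]).
  assert (B4 : rho <= r2 / (Q * L)) by (eapply Rle_trans; [apply Rmin_r|apply Rmin_r]).
  (* Through a [b]-syllable, [H] expands by [L], the power of [g] by [Q] and [K] by [1 / c].
     Replacing [H] by [H'] costs [Q * eta / c], and replacing [K] by [K'] costs [eta / c]. *)
  set (D := (Q * L + Q + 1) / c). assert (HD : 0 < D) by (apply Rdiv_lt_0_compat; nra).
  assert (HDc : D * c = Q * L + Q + 1) by (unfold D; field; lra).
  assert (HHr : forall H K z, good c L r1 r2 H K -> Cmod z < rho ->
    Cmod (H z) < r /\ forall n, (n <= l)%nat -> Cmod (iter n g (H z)) <= Q * L * Cmod z /\
                                               Cmod (iter n g (H z)) < r2).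
  { intros H K z HG Hz. destruct (good_bound _ _ _ _ _ _ z HG ltac:(lra)) as [_ A].
    assert (A' : Cmod (H z) < r).
    { apply Rle_lt_trans with (1 := A). apply Rlt_le_trans with (L * (r / L)).
      - apply Rmult_lt_compat_l; lra.
      - right; field; lra. }
    split; auto. intros n Hn. pose proof (periodic_on_bound g l r Q n (H z) Hg Hn A').
    assert (E : Cmod (iter n g (H z)) <= Q * L * Cmod z) by nra. split; auto.
    apply Rle_lt_trans with (1 := E). apply Rlt_le_trans with (Q * L * (r2 / (Q * L))).
    - apply Rmult_lt_compat_l; lra.
    - right; field; lra. }
  exists rho, (Q + D). repeat split; auto; try lra.
  - destruct (HHr _ _ _ H0 H3); auto.
  - intros n Hn. destruct (HHr _ _ _ H0 H3) as [_ A]. apply A; auto.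
  - destruct b.
    + destruct Hf as (_ & Hf & _). apply holo_mono with r; auto. apply Hf; auto.
    + pose proof H0 as (HHh & _ & _ & HKh & _). destruct Hg as (_ & Hg & _).
      apply (holo_comp rho r2 K (fun z => iter n g (H z))); auto.
      * apply (holo_comp rho r (iter n g) H); [apply Hg; auto|apply holo_mono with r1; auto|].
        intros z Hz. eapply HHr; eauto.
      * intros z Hz. destruct (HHr _ _ _ H0 Hz) as [_ A]. apply A; auto.
  - intros z Hz. pose proof (Cmod_ge_0 z). destruct b; simpl.
    + pose proof (periodic_on_bound f k r Q n z Hf H3 ltac:(lra)). nra.
    + destruct (HHr _ _ _ H0 Hz) as [_ A]. destruct (A n H3) as [A1 A2].
      destruct (H0) as (_ & _ & _ & _ & HK). destruct (HK _ A2) as [K1 K2].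
      destruct (good_bound _ _ _ _ _ _ _ H0 K1) as [G _]. rewrite K2 in G.
      apply Rmult_le_reg_l with c; auto.
      replace (c * ((Q + D) * Cmod z)) with (c * Q * Cmod z + (D * c) * Cmod z) by ring.
      rewrite HDc.
      assert (0 <= c * Q * Cmod z) by (repeat apply Rmult_le_pos; lra).
      assert (0 <= Q * Cmod z) by (apply Rmult_le_pos; lra). nra.
  - intros H K H' K' eta HG HG' Heta b n Hn x x' Hx Hx'.
    pose proof (Cmod_ge_0 (x - x')) as Hd.
    assert (He0 : 0 <= eta).
    { eapply Rle_trans; [apply Cmod_ge_0|apply (Heta 0%C); rewrite Cmod_0; auto]. }
    destruct b; simpl.
    + destruct Hf as (_ & Hf & _). destruct (Hf n Hn) as (_ & A & _).
      specialize (A x x' ltac:(lra) ltac:(lra)). nra.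
    + destruct (HHr _ _ _ HG Hx) as [X1 X2]. destruct (X2 n Hn) as [_ X3].
      destruct (HHr _ _ _ HG' Hx') as [Y1 Y2]. destruct (Y2 n Hn) as [_ Y3].
      assert (S1 : Cmod (H x - H' x') <= L * Cmod (x - x') + eta).
      { pose proof (Cmod_sub_triangle (H x) (H x') (H' x')).
        specialize (Heta x' ltac:(lra)). destruct HG as (_ & _ & Hb & _).
        specialize (Hb x x' ltac:(lra) ltac:(lra)). lra. }
      assert (S2 : Cmod (iter n g (H x) - iter n g (H' x')) <= Q * (L * Cmod (x - x') + eta)).
      { destruct Hg as (_ & Hg & _). destruct (Hg n Hn) as (_ & A & _).
        specialize (A _ _ X1 Y1). nra. }
      set (y := iter n g (H x)) in *. set (y' := iter n g (H' x')) in *.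
      destruct HG as (_ & _ & Hb & _ & HK). destruct HG' as (_ & _ & _ & _ & HK').
      destruct (HK y X3) as [K1 K2]. destruct (HK' y' Y3) as [K3 K4].
      destruct (Hb (K y) (K' y') K1 K3) as [Hb' _]. rewrite K2 in Hb'.
      (* The two inverses are compared through [H]: at the point [K' y'] it differs by at most [eta]
         from [H'], whose value there is [y']. *)
      specialize (Heta (K' y') K3). rewrite K4 in Heta.
      pose proof (Cmod_sub_triangle y y' (H (K' y'))) as T. rewrite (Cmod_sub_sym y') in T.
      apply Rmult_le_reg_l with c; auto.
      replace (c * ((Q + D) * (Cmod (x - x') + eta)))
        with (c * Q * (Cmod (x - x') + eta) + (D * c) * (Cmod (x - x') + eta)) by ring.
      rewrite HDc.
      assert (0 <= c * Q * (Cmod (x - x') + eta)) by (apply Rmult_le_pos; nra).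
      assert (0 <= Q * Cmod (x - x')) by nra. assert (0 <= Q * L * eta) by nra. nra.
Qed.

Lemma reduced_bound k l (b : bool) n t : reduced k l ((b, n) :: t) -> (n <= if b then k else l)%nat.
Proof. simpl. intros [H _]. destruct b; lia. Qed.

(** Each syllable expands moduli by at most [P], so a start within [rho / P ^ length s] keeps every
    intermediate point in the disc of radius [rho]. *)
Lemma syl_eval_control f g k l r c L r1 r2 rho P H K s :
  controlled f g k l r c L r1 r2 rho P -> good c L r1 r2 H K -> reduced k l s ->
  holo (rho / P ^ length s) (syl_eval f g H K s) /\
  forall z, Cmod z < rho / P ^ length s -> Cmod (syl_eval f g H K s z) <= P ^ length s * Cmod z.
Proof.
  intros (Hrho & _ & _ & HP & HC & _) HG.
  destruct (HC H K HG) as [_ HS]. clear HC.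
  induction s as [|[b n] t IH]; intros Hs.
  - split; [apply holo_id|]. intros z _. simpl. lra.
  - pose proof (reduced_bound _ _ _ _ _ Hs) as Hn. destruct Hs as (_ & _ & Ht).
    destruct (IH Ht) as [I1 I2]. destruct (HS b n Hn) as [S1 S2]. simpl length.
    assert (HPn : 0 < P ^ length t) by (apply pow_lt; lra).
    assert (Hle : rho / P ^ S (length t) <= rho / P ^ length t).
    { apply Rmult_le_compat_l; [lra|]. apply Rinv_le_contravar; auto. simpl. nra. }
    assert (Hin : forall z, Cmod z < rho / P ^ S (length t) -> Cmod (syl_eval f g H K t z) < rho).
    { intros z Hz. specialize (I2 z ltac:(lra)). apply Rle_lt_trans with (1 := I2).
      apply Rlt_le_trans with (P ^ length t * (rho / P ^ length t)); [apply Rmult_lt_compat_l; lra|].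
      right; field; lra. }
    split.
    + apply holo_ext with (fun z => syl_step f g H K b n (syl_eval f g H K t z)).
      { intros; symmetry; apply syl_eval_cons. }
      apply holo_comp with rho; auto. apply holo_mono with (rho / P ^ length t); auto.
    + intros z Hz. rewrite syl_eval_cons. specialize (S2 _ (Hin z Hz)).
      specialize (I2 z ltac:(lra)). simpl. nra.
Qed.

(** The constant obeys the recursion [M -> P * (M + 1)] along the word, so it depends on [s] but not
    on the maps compared. *)
Lemma syl_eval_close f g k l r c L r1 r2 rho P s :
  controlled f g k l r c L r1 r2 rho P -> reduced k l s ->
  exists M, 0 <= M /\ forall H K H' K' eta, good c L r1 r2 H K -> good c L r1 r2 H' K' ->
    (forall z, Cmod z < r1 -> Cmod (H z - H' z) <= eta) ->
    forall z, Cmod z < rho / P ^ length s ->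
      Cmod (syl_eval f g H K s z - syl_eval f g H' K' s z) <= M * eta.
Proof.
  intros HC. pose proof HC as (Hrho & _ & Hr1 & HP & _ & HX).
  induction s as [|[b n] t IH]; intros Hs.
  - exists 0. split; [lra|]. intros. simpl. replace (z - z)%C with (RtoC 0) by ring. rewrite Cmod_0. lra.
  - pose proof (reduced_bound _ _ _ _ _ Hs) as Hn. destruct Hs as (_ & _ & Ht).
    destruct (IH Ht) as [M [HM HM']]. exists (P * (M + 1)). split; [nra|].
    intros H K H' K' eta HG HG' Heta z Hz. rewrite !syl_eval_cons.
    assert (HPn : 0 < P ^ length t) by (apply pow_lt; lra).
    simpl length in Hz.
    assert (Hle : rho / P ^ S (length t) <= rho / P ^ length t).
    { apply Rmult_le_compat_l; [lra|]. apply Rinv_le_contravar; auto. simpl. nra. }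
    assert (Hin : forall H K, good c L r1 r2 H K -> Cmod (syl_eval f g H K t z) < rho).
    { intros H0 K0 HG0. destruct (syl_eval_control f g k l r c L r1 r2 rho P H0 K0 t HC HG0 Ht) as [_ I2].
      specialize (I2 z ltac:(lra)). apply Rle_lt_trans with (1 := I2).
      apply Rlt_le_trans with (P ^ length t * (rho / P ^ length t)); [apply Rmult_lt_compat_l; lra|].
      right; field; lra. }
    specialize (HX H K H' K' eta HG HG' Heta b n Hn _ _ (Hin H K HG) (Hin H' K' HG')).
    specialize (HM' H K H' K' eta HG HG' Heta z ltac:(lra)). nra.
Qed.

Lemma syl_eval_identity f g k l r c L r1 r2 rho P H K s :
  controlled f g k l r c L r1 r2 rho P -> good c L r1 r2 H K -> reduced k l s ->
  germ_id (syl_eval f g H K s) ->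
  forall z, Cmod z < rho / P ^ length s -> syl_eval f g H K s z = z.
Proof.
  intros HC HG Hs [d [Hd Hid]] z Hz.
  destruct (syl_eval_control _ _ _ _ _ _ _ _ _ _ _ _ _ _ HC HG Hs) as [Hh _].
  pose proof (identity_theorem (fun z => syl_eval f g H K s z + (- (1)) * z)%C _ d
    (holo_plus _ _ _ Hh (holo_mult _ _ _ (holo_const _ _) (holo_id _))) Hd) as I.
  assert (E : (syl_eval f g H K s z + - (1) * z)%C = 0%C).
  { apply I; auto. intros x Hx. rewrite Hid by auto. ring. }
  replace (syl_eval f g H K s z) with (syl_eval f g H K s z + - (1) * z + z)%C by ring.
  rewrite E. ring.
Qed.

(** * From maps on fixed discs back to germs *)

Lemma good_germs c L r1 r2 H K : 0 < c -> 0 < r1 -> 0 < r2 -> good c L r1 r2 H K ->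
  germ0 H /\ germ0 K /\ germ_id (fun y => H (K y)).
Proof.
  intros Hc H1 H2 HG. pose proof HG as (HH & H0 & Hb & HK & HHK).
  assert (K0 : K 0%C = 0%C).
  { destruct (HHK 0%C) as [A B]; [rewrite Cmod_0; auto|].
    destruct (good_bound _ _ _ _ _ _ _ HG A) as [G _]. rewrite B, Cmod_0 in G.
    apply Cmod_eq_0. pose proof (Cmod_ge_0 (K 0%C)). nra. }
  split; [|split].
  - split; auto. exists r1; auto.
  - split; auto. exists r2; auto.
  - exists r2. split; auto. intros z Hz. apply HHK; auto.
Qed.

Lemma germ_id_conjugate p q h hi :
  germ0 p -> germ0 q -> germ0 h -> germ0 hi ->
  germ_id (fun z => h (hi z)) -> germ_id (fun z => hi (h z)) -> germ_id (fun z => p (q z)) ->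
  germ_id (fun z => hi (p (h (hi (q (h z)))))).
Proof.
  intros Hp Hq Hh Hhi E1 E2 E.
  assert (Hqh : germ0 (fun z => q (h z))) by (apply germ0_comp; auto).
  apply germ_eq_trans with (fun z => hi (p (q (h z)))).
  - apply (germ_eq_comp (fun z => hi (p z)) (fun z => hi (p z)) (fun z => h (hi (q (h z))))
             (fun z => q (h z))); auto using germ_eq_refl.
    + apply (germ_eq_comp (fun z => h (hi z)) (fun z => z)); auto using germ_eq_refl.
    + apply (germ0_comp (fun z => h (hi z)) (fun z => q (h z))); auto. apply germ0_comp; auto.
  - apply germ_eq_trans with (fun z => hi (h z)); auto.
    apply (germ_eq_comp hi hi (fun z => p (q (h z))) h); auto using germ_eq_refl.
    + apply (germ_eq_comp (fun z => p (q z)) (fun z => z) h h); auto using germ_eq_refl.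
    + apply (germ0_comp p (fun z => q (h z))); auto.
Qed.

Lemma conjugate_sound f g h fi gi hi k l u v :
  isDiff f -> isDiff g -> isDiff h -> germ_id (iter k f) -> germ_id (iter l g) ->
  germ_inv f fi -> germ_inv g gi -> germ_inv h hi -> pres_eq k l u v ->
  germ_eq (eval_word f fi (fun z => hi (g (h z))) (fun z => hi (gi (h z))) u)
          (eval_word f fi (fun z => hi (g (h z))) (fun z => hi (gi (h z))) v).
Proof.
  intros Hf Hg Hh Hk Hl If Ig Ih.
  apply germ0_isDiff in Hf, Hg, Hh.
  pose proof (germ0_inv _ _ If). pose proof (germ0_inv _ _ Ig). pose proof (germ0_inv _ _ Ih).
  destruct If as (_ & _ & F1 & F2). destruct Ig as (_ & _ & G1 & G2). destruct Ih as (_ & _ & H1' & H2').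
  assert (Hc : forall p, germ0 p -> germ0 (fun z => hi (p (h z)))).
  { intros p Hp. apply (germ0_comp hi (fun z => p (h z))); auto. apply germ0_comp; auto. }
  apply eval_word_sound; auto.
  - apply germ_id_conjugate; auto.
  - apply germ_id_conjugate; auto.
  - apply germ_eq_trans with (fun z => hi (iter l g (h z))); [apply iter_conjugate; auto|].
    apply germ_eq_trans with (fun z => hi (h z)); auto.
    apply (germ_eq_comp hi hi (fun z => iter l g (h z)) h); auto using germ_eq_refl.
    + apply (germ_eq_comp (iter l g) (fun z => z) h h); auto using germ_eq_refl.
    + apply (germ0_comp (iter l g) h); auto using germ0_iter.
Qed.

Lemma eval_word_syl f g h fi gi hi k l w s H K :
  isDiff f -> isDiff g -> isDiff h -> germ_id (iter k f) -> germ_id (iter l g) ->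
  germ_inv f fi -> germ_inv g gi -> germ_inv h hi -> pres_eq k l w (spell s) ->
  germ0 H -> germ0 K -> germ_eq h H -> germ_id (fun y => H (K y)) ->
  (germ_id (eval_word f fi (fun z => hi (g (h z))) (fun z => hi (gi (h z))) w) <->
   germ_id (syl_eval f g H K s)).
Proof.
  intros Hf Hg Hh Hk Hl If Ig Ih Hw HH HK E HHK.
  assert (A := conjugate_sound f g h fi gi hi k l w (spell s) Hf Hg Hh Hk Hl If Ig Ih Hw).
  assert (B : germ_eq (eval_word f fi (fun z => hi (g (h z))) (fun z => hi (gi (h z))) (spell s))
                      (syl_eval f g H K s)).
  { apply eval_spell; auto using germ0_isDiff; eapply germ0_inv; eauto. }
  pose proof (germ_eq_trans _ _ _ A B) as D. split; intros X.
  - exact (germ_eq_trans _ _ _ (germ_eq_sym _ _ D) X).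
  - exact (germ_eq_trans _ _ _ D X).
Qed.

(** * Openness *)

(** Words trivial in the presentation impose nothing, so the intersection may run over all words. *)
Definition word_moves (f g : C -> C) (k l : nat) (w : word) (h : C -> C) : Prop :=
  ~ pres_eq k l w nil ->
  forall fi gi hi, germ_inv f fi -> germ_inv g gi -> germ_inv h hi ->
    ~ germ_id (eval_word f fi (fun z => hi (g (h z))) (fun z => hi (gi (h z))) w).

Lemma local_setup f g k l h :
  isDiff f -> isDiff g -> has_period f k -> has_period g l -> isDiff h ->
  exists R0 e0 r Q c L r1 r2 rho P,
    0 < R0 /\ 0 < e0 /\ 0 < c /\ 0 < r1 /\ 0 < r2 /\
    periodic_on f k r Q /\ periodic_on g l r Q /\
    controlled f g k l r c L r1 r2 rho P /\
    forall phi, holo R0 phi -> phi 0%C = 0%C -> (forall z, Cmod z < R0 -> Cmod (phi z) <= e0) ->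
      exists K, good c L r1 r2 (fun z => h z + phi z)%C K.
Proof.
  intros Hf Hg Pf Pg Hh.
  destruct (periodic_on_exists f k Hf Pf) as [rf [Qf [Hrf [HQf PF]]]].
  destruct (periodic_on_exists g l Hg Pg) as [rg [Qg [Hrg [HQg PG]]]].
  set (r := Rmin rf rg). set (Q := Rmax Qf Qg).
  assert (Hr : 0 < r) by (apply Rmin_pos; auto).
  pose proof (Rmin_l rf rg : r <= rf). pose proof (Rmin_r rf rg : r <= rg).
  pose proof (Rmax_l Qf Qg : Qf <= Q). pose proof (Rmax_r Qf Qg : Qg <= Q).
  assert (PF' : periodic_on f k r Q) by (apply (periodic_on_mono f k rf Qf); auto; lra).
  assert (PG' : periodic_on g l r Q) by (apply (periodic_on_mono g l rg Qg); auto; lra).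
  destruct (isDiff_derivative h Hh) as [d [Hd0 Hd]].
  destruct (germ0_isDiff h Hh) as [h0 [rh [Hrh Hhol]]].
  destruct (perturbation_good rh h d Hrh Hhol h0 Hd0 Hd)
    as (R0 & e0 & c & L & r1 & r2 & HR0 & He0 & Hc & HL & Hr1 & Hr2 & HP).
  destruct (controlled_exists f g k l r Q c L r1 r2) as [rho [P HC]]; auto; [lra|].
  exists R0, e0, r, Q, c, L, r1, r2, rho, P. do 8 (split; [lra || assumption|]). exact HP.
Qed.

Lemma basic_perturbation h r eps h' : isDiff h -> isDiff h' -> basic h r eps h' ->
  exists phi e, holo r phi /\ phi 0%C = 0%C /\ germ_eq h' (fun z => h z + phi z)%C /\
    e < eps /\ forall z, Cmod z < r -> Cmod (phi z) <= e.
Proof.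
  intros (_ & h0 & _) (_ & h0' & _) (phi & Hphi & [d [Hd E]] & e & He & Hb).
  exists phi, e. split; [apply holo_on_disc; auto|]. repeat split; auto.
  - rewrite E by (rewrite Cmod_0; auto). rewrite h0, h0'. ring.
  - exists d. split; auto. intros z Hz. rewrite E by auto. ring.
Qed.

Lemma basic_intro h r eps h' phi e :
  holo r phi -> germ_eq phi (fun z => h' z - h z)%C -> e < eps ->
  (forall z, Cmod z < r -> Cmod (phi z) <= e) -> basic h r eps h'.
Proof.
  intros Hphi E He Hb. exists phi. split; [apply holo_on_disc; auto|]. split; auto. exists e. auto.
Qed.

Lemma basic_refl h r eps : 0 < eps -> basic h r eps h.
Proof.
  intros He. apply basic_intro with (fun _ => RtoC 0) 0; auto.
  - apply holo_const.
  - apply germ_eq_ext. intros; ring.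
  - intros. rewrite Cmod_0. lra.
Qed.

Lemma has_period_id f k : has_period f k -> germ_id (iter k f).
Proof. intros (_ & H & _). exact H. Qed.

Lemma word_moves_open f g k l w :
  isDiff f -> isDiff g -> has_period f k -> has_period g l -> an_open (word_moves f g k l w).
Proof.
  intros Hf Hg Pf Pg h Hh HU.
  destruct (classic (pres_eq k l w nil)) as [Hw|Hw].
  { exists h, 1, 1. split; [auto|]. split; [lra|]. split; [lra|]. split; [apply basic_refl; lra|].
    intros h' _ _ Hn. contradiction. }
  assert (Hk : (0 < k)%nat) by (destruct Pf; auto). assert (Hl : (0 < l)%nat) by (destruct Pg; auto).
  pose proof (has_period_id f k Pf) as If. pose proof (has_period_id g l Pg) as Ig.
  destruct (normal_form k l w Hk Hl) as [s [Hs Es]].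
  destruct (local_setup f g k l h Hf Hg Pf Pg Hh)
    as (R0 & e0 & r & Q & c & L & r1 & r2 & rho & P & HR0 & He0 & Hc & H1 & H2 & PF & PG & HC & HP).
  pose proof HC as (Hrho & _ & _ & HP1 & _).
  destruct (HP (fun _ => 0%C)) as [K0 HG0].
  { apply holo_const. } { auto. } { intros. rewrite Cmod_0. lra. }
  destruct (good_germs _ _ _ _ _ _ Hc H1 H2 HG0) as (G1 & G2 & G3).
  (* The unperturbed map is treated as the perturbation by [0], so that it shares the constants of
     its neighbours; if it fixed the whole disc, the word would be the identity germ. *)
  assert (Hz : exists z, Cmod z < rho / P ^ length s /\ syl_eval f g (fun z => h z + 0)%C K0 s z <> z).
  { apply NNPP. intros Hno.
    pose proof Hf as (_ & _ & fi & Ifi). pose proof Hg as (_ & _ & gi & Igi). pose proof Hh as (_ & _ & hi & Ihi).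
    apply (HU Hw fi gi hi Ifi Igi Ihi).
    apply (eval_word_syl f g h fi gi hi k l w s (fun z => h z + 0)%C K0); auto.
    - apply germ_eq_ext. intros; ring.
    - exists (rho / P ^ length s). split; [apply Rdiv_lt_0_compat; auto; apply pow_lt; lra|].
      intros z Hz. apply NNPP. intros Hn. apply Hno. exists z; auto. }
  destruct Hz as [z0 [Hz0 Hmove]].
  set (d := Cmod (syl_eval f g (fun z => h z + 0)%C K0 s z0 - z0)).
  assert (Hd : 0 < d).
  { apply Cmod_gt_0. intros E. apply Hmove.
    apply Cmod_sub_eq0. rewrite E, Cmod_0. lra. }
  destruct (syl_eval_close f g k l r c L r1 r2 rho P s HC Hs) as [M [HM Hclose]].
  (* The word at [z0] then varies by at most [M * eps < d], too little to bring [z0] back to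
     itself. *)
  set (eps := Rmin e0 (d / (M + 1))).
  assert (Heps : 0 < eps) by (apply Rmin_pos; auto; apply Rdiv_lt_0_compat; lra).
  pose proof (Rmin_l e0 (d / (M + 1)) : eps <= e0). pose proof (Rmin_r e0 (d / (M + 1)) : eps <= _).
  (* Smallness on radius [R0] makes the perturbed map [good]; smallness on radius [r1] is what
     [syl_eval_close] compares. *)
  exists h, (Rmax R0 r1), eps. split; [auto|]. split; [apply Rlt_le_trans with R0; auto; apply Rmax_l|].
  split; [auto|]. split; [apply basic_refl; auto|].
  intros h' Hh' Hb _ fi gi hi Ifi Igi Ihi Hid.
  destruct (basic_perturbation h _ _ h' Hh Hh' Hb) as (phi & e & P1 & P2 & P3 & P4 & P5).
  pose proof (Rmax_l R0 r1). pose proof (Rmax_r R0 r1).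
  destruct (HP phi) as [K HG]; auto.
  { apply holo_mono with (Rmax R0 r1); auto. }
  { intros z Hz. specialize (P5 z ltac:(lra)). lra. }
  destruct (good_germs _ _ _ _ _ _ Hc H1 H2 HG) as (G1' & G2' & G3').
  apply (eval_word_syl f g h' fi gi hi k l w s (fun z => h z + phi z)%C K) in Hid; auto.
  pose proof (syl_eval_identity _ _ _ _ _ _ _ _ _ _ _ _ _ _ HC HG Hs Hid z0 Hz0) as E.
  assert (Hcl : d <= M * eps).
  { unfold d. rewrite <- E at 2. apply Hclose; auto.
    intros z Hz. replace (h z + 0 - (h z + phi z))%C with (- phi z)%C by ring. rewrite Cmod_opp.
    specialize (P5 z ltac:(lra)). lra. }
  assert (Hlt : M * eps <= M * (d / (M + 1))) by (apply Rmult_le_compat_l; lra).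
  assert (Heq : (M + 1) * (d / (M + 1)) = d) by (field; lra).
  assert (0 < d / (M + 1)) by (apply Rdiv_lt_0_compat; lra). nra.
Qed.

(** * Density *)

(** The polynomial [z] times the product of [z - a] over the [a] in [S] other than [x]. *)
Lemma interpolating_function (S : list C) (x : C) : x <> 0%C ->
  exists q : C -> C, (forall r, holo r q) /\ q 0%C = 0%C /\ q x <> 0%C /\
    (forall p, In p S -> p <> x -> q p = 0%C) /\
    forall r, 0 < r -> exists M, 0 < M /\ forall z, Cmod z < r -> Cmod (q z) <= M.
Proof.
  intros Hx. induction S as [|a S (q & Q1 & Q2 & Q3 & Q4 & Q5)].
  - exists (fun z => z). repeat split; auto.
    + intros; apply holo_id.
    + intros p [].
    + intros r Hr. exists r. split; auto. intros; lra.
  - destruct (excluded_middle_informative (a = x)) as [->|Ha].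
    + exists q. repeat split; auto. intros p [<-|Hp] Hn; [contradiction|auto].
    + exists (fun z => q z * (z + - a))%C. repeat split.
      * intros r. apply holo_mult; auto. apply holo_plus; [apply holo_id|apply holo_const].
      * rewrite Q2. ring.
      * apply Cmult_neq_0; auto. intros E. apply Ha.
        replace x with (x + - a + a)%C by ring. rewrite E. ring.
      * intros p [<-|Hp] Hn; [ring|]. rewrite Q4 by auto. ring.
      * intros r Hr. destruct (Q5 r Hr) as [M [HM HM']]. pose proof (Cmod_ge_0 a).
        exists (M * (r + Cmod a)). split; [nra|]. intros z Hz. rewrite Cmod_mult.
        apply Rmult_le_compat; try apply Cmod_ge_0; auto.
        eapply Rle_trans; [apply Cmod_triangle|]. rewrite Cmod_opp. lra.
Qed.

(** Each element forbids at most one parameter, so all parameters below the smallest forbidden one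
    are free. *)
Lemma avoid_finitely_many {X} (bad : X -> R -> Prop) (S : list X) (t0 : R) : 0 < t0 ->
  (forall p t t', 0 < t < t0 -> 0 < t' < t0 -> bad p t -> bad p t' -> t = t') ->
  exists t, 0 < t < t0 /\ forall p, In p S -> ~ bad p t.
Proof.
  intros Ht0 Hu.
  assert (H : exists t1, 0 < t1 <= t0 /\ forall t, 0 < t < t1 -> forall p, In p S -> ~ bad p t).
  { induction S as [|a S [t1 [H1 H1']]].
    - exists t0. split; [lra|]. intros t _ p [].
    - destruct (classic (exists t, 0 < t < t1 /\ bad a t)) as [[t2 [H2 B2]]|Hn].
      + exists t2. split; [lra|]. intros t Ht p [<-|Hp].
        * intros B. assert (t = t2) by (apply (Hu a); auto; lra). lra.
        * apply H1'; auto; lra.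
      + exists t1. split; [lra|]. intros t Ht p [<-|Hp]; [|apply H1'; auto].
        intros B. apply Hn. eauto. }
  destruct H as [t1 [H1 H2]]. exists (t1 / 2). split; [lra|]. apply H2. lra.
Qed.

(* [orb s x T]: the syllables of [s] lead from [z0] to [x], through the points of
   [T] (latest first); a [b]-syllable is recorded without inverting [H]. *)
Inductive orb (f g H : C -> C) (P : R) (z0 : C) : list syllable -> C -> list C -> Prop :=
| orb_nil : orb f g H P z0 nil z0 nil
| orb_a n s x T : orb f g H P z0 s x T -> orb f g H P z0 ((true, n) :: s) (iter n f x) (x :: T)
| orb_b n s x T x' : orb f g H P z0 s x T -> H x' = iter n g (H x) -> Cmod x' <= P * Cmod x ->
    orb f g H P z0 ((false, n) :: s) x' (x :: T).

Lemma orb_agree f g H H' P z0 s x T :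
  orb f g H P z0 s x T -> (forall y, In y (x :: T) -> H' y = H y) -> orb f g H' P z0 s x T.
Proof.
  induction 1 as [|n s x T Ho IH|n s x T x' Ho IH E HP]; intros HA.
  - constructor.
  - constructor. apply IH. intros y Hy. apply HA. right; auto.
  - constructor; auto.
    + apply IH. intros y Hy. apply HA. right; auto.
    + rewrite !HA; simpl; auto.
Qed.

(** Unless the last syllable is a [b], the map has not been used at the endpoint [x], and its value
    there remains free. Alternation of syllables guarantees this before each [b]. *)
Lemma orb_agree_tail f g H H' P z0 s x T :
  match s with (false, _) :: _ => False | _ => True end ->
  orb f g H P z0 s x T -> (forall y, In y T -> H' y = H y) -> orb f g H' P z0 s x T.
Proof.
  intros Hs Ho HA. destruct Ho; [constructor| |contradiction].
  constructor. apply orb_agree with H; auto.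
Qed.

(** The recorded bound [Cmod x' <= P * Cmod x] keeps [x'] in the disc where [H] is injective, so the
    equation for [H x'] forces [x'] to be the value of [K]. *)
Lemma orb_eval f g k l r c L r1 r2 rho P H K z0 s x T :
  0 < c -> controlled f g k l r c L r1 r2 rho P -> good c L r1 r2 H K -> reduced k l s ->
  Cmod z0 < rho / P ^ length s -> orb f g H P z0 s x T -> x = syl_eval f g H K s z0.
Proof.
  intros Hc HC HG Hs Hz Ho. pose proof HC as (Hrho & _ & Hr1 & HP & HX & _).
  assert (Hshrink : forall m, rho / P ^ S m <= rho / P ^ m).
  { intros m. apply Rmult_le_compat_l; [lra|]. apply Rinv_le_contravar; [apply pow_lt; lra|].
    assert (0 < P ^ m) by (apply pow_lt; lra). simpl. nra. }
  revert Hs Hz. induction Ho as [|n s x T Ho IH|n s x T x' Ho IH E HPx]; intros Hs Hz; auto.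
  - rewrite syl_eval_cons. simpl. rewrite <- IH; auto.
    + apply Hs.
    + simpl length in Hz. specialize (Hshrink (length s)). lra.
  - pose proof (reduced_bound _ _ _ _ _ Hs) as Hn.
    assert (Ht : reduced k l s) by apply Hs. simpl length in Hz.
    pose proof (Hshrink (length s)) as Hsh.
    rewrite syl_eval_cons. simpl. rewrite <- IH by (auto; lra).
    destruct (syl_eval_control _ _ _ _ _ _ _ _ _ _ _ _ _ _ HC HG Ht) as [_ I2].
    specialize (I2 z0 ltac:(lra)). rewrite <- IH in I2 by (auto; lra).
    assert (HPn : 0 < P ^ length s) by (apply pow_lt; lra).
    assert (Hx' : P * Cmod x < rho).
    { apply Rle_lt_trans with (P ^ S (length s) * Cmod z0); [simpl; nra|].
      apply Rlt_le_trans with (P ^ S (length s) * (rho / P ^ S (length s))).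
      - apply Rmult_lt_compat_l; auto. apply pow_lt; lra.
      - right; field. apply pow_nonzero; lra. }
    pose proof (Cmod_ge_0 x).
    assert (Hx : Cmod x < rho) by nra.
    destruct (HX H K HG) as [X1 _]. destruct (X1 x Hx) as [_ X2]. specialize (X2 n Hn).
    pose proof HG as (_ & _ & Hb & _ & HK). destruct (HK _ X2) as [K1 K2].
    destruct (Hb x' (K (iter n g (H x)))) as [B _]; [lra|auto|].
    rewrite K2, E in B. replace (iter n g (H x) - iter n g (H x))%C with (RtoC 0) in B by ring.
    rewrite Cmod_0 in B. apply Cmod_sub_eq0.
    pose proof (Cmod_ge_0 (x' - K (iter n g (H x)))). nra.
Qed.

(** The bound [e] stays strictly below [eps], leaving room for a further perturbation at each
    syllable. *)
Definition small_entire (Rb eps : R) (phi : C -> C) : Prop :=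
  (forall r, holo r phi) /\ phi 0%C = 0%C /\
  exists e, 0 <= e < eps /\ forall z, Cmod z < Rb -> Cmod (phi z) <= e.

Lemma small_entire_perturb Rb eps phi q : 0 < Rb -> small_entire Rb eps phi ->
  (forall r, holo r q) -> q 0%C = 0%C ->
  (forall r, 0 < r -> exists M, 0 < M /\ forall z, Cmod z < r -> Cmod (q z) <= M) ->
  exists t0, 0 < t0 /\ forall t : R, 0 < t < t0 -> small_entire Rb eps (fun z => phi z + t * q z)%C.
Proof.
  intros HRb (A1 & A2 & e & He & A3) B1 B2 B3. destruct (B3 Rb HRb) as [M [HM HM']].
  (* Half of the margin [eps - e] is spent; the new bound is the midpoint of [e] and [eps]. *)
  exists ((eps - e) / (2 * M)). split; [apply Rdiv_lt_0_compat; lra|]. intros t Ht. repeat split.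
  - intros r. apply holo_plus; auto. apply holo_mult; [apply holo_const|auto].
  - rewrite A2, B2. ring.
  - exists ((e + eps) / 2). split; [lra|]. intros z Hz.
    eapply Rle_trans; [apply Cmod_triangle|]. rewrite Cmod_mult, Cmod_R, Rabs_right by lra.
    specialize (A3 z Hz). specialize (HM' z Hz). pose proof (Cmod_ge_0 (q z)).
    assert (t * Cmod (q z) <= (eps - e) / (2 * M) * M) by (apply Rmult_le_compat; lra).
    replace ((eps - e) / (2 * M) * M) with ((eps - e) / 2) in * by (field; lra). lra.
Qed.

Lemma periodic_on_injective f k r Q n z z' : periodic_on f k r Q -> (n <= k)%nat ->
  Cmod z < r -> Cmod z' < r -> iter n f z = iter n f z' -> z = z'.
Proof.
  intros (_ & _ & Hp) Hn Hz Hz' E. rewrite <- (Hp z), <- (Hp z') by auto.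
  replace k with ((k - n) + n)%nat by lia. rewrite !iter_add, E. reflexivity.
Qed.

(* Moving the value of [H] at the single point [x] shifts the image of [x] under the
   next [b]-syllable, so that it avoids any finite set, and leaves the earlier orbit unchanged. *)
Lemma orb_extend_b f g k l h Rb eps r Q c L r1 r2 rho P phi (z0 : C) s (x : C) T m (S : list C) :
  0 < Rb -> 0 < c -> periodic_on g l r Q -> controlled f g k l r c L r1 r2 rho P ->
  (forall phi, small_entire Rb eps phi -> exists K, good c L r1 r2 (fun z => h z + phi z)%C K) ->
  small_entire Rb eps phi -> orb f g (fun z => h z + phi z)%C P z0 s x T ->
  match s with (false, _) :: _ => False | _ => True end ->
  x <> 0%C -> NoDup (x :: T) -> Cmod x < rho -> (0 < m < l)%nat ->
  exists phi' x', small_entire Rb eps phi' /\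
    orb f g (fun z => h z + phi' z)%C P z0 ((false, m) :: s) x' (x :: T) /\ ~ In x' S.
Proof.
  intros HRb Hc HG HC HP Hphi Ho Hs Hx0 Hnd Hx Hm.
  (* Vanishing on [T] preserves the orbit so far. Vanishing on [S] makes the value of the perturbed
     map at a forbidden point independent of [t], so that such a point is hit for one [t] at most,
     [iter m g] being injective. *)
  destruct (interpolating_function (T ++ S) x Hx0) as (q & Q1 & Q2 & Q3 & Q4 & Q5).
  destruct (small_entire_perturb Rb eps phi q HRb Hphi Q1 Q2 Q5) as [t0 [Ht0 Hsmall]].
  pose proof HC as (Hrho & Hr & Hr1 & HP1 & HX & _).
  destruct (avoid_finitely_many
    (fun p (t : R) => p <> x /\ (h p + phi p)%C = iter m g (h x + (phi x + t * q x))%C) S t0 Ht0)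
    as [t [Ht Hbad]].
  { intros p t t' Ht Ht' [_ E1] [_ E2]. rewrite E1 in E2.
    destruct (HP _ (Hsmall t Ht)) as [K HK]. destruct (HP _ (Hsmall t' Ht')) as [K' HK'].
    destruct (HX _ _ HK) as [X1 _]. destruct (HX _ _ HK') as [X1' _].
    destruct (X1 x Hx) as [X2 _]. destruct (X1' x Hx) as [X2' _].
    assert (E : (h x + (phi x + t * q x))%C = (h x + (phi x + t' * q x))%C)
      by (apply (periodic_on_injective g l r Q m); auto; lia).
    assert (E3 : ((t - t') * q x)%C = 0%C).
    { replace ((t - t') * q x)%C
        with ((h x + (phi x + t * q x)) - (h x + (phi x + t' * q x)))%C by ring.
      rewrite E. ring. }
    apply NNPP. intros Hn. rewrite <- RtoC_minus in E3.
    apply (Cmult_neq_0 (RtoC (t - t')) (q x)); auto.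
    intros E4. apply RtoC_inj in E4. lra. }
  pose (phi' := fun z => (phi z + t * q z)%C). fold phi' in Hsmall.
  pose proof (Hsmall t Ht) as Hs'. change (small_entire Rb eps phi') in Hs'.
  destruct (HP phi' Hs') as [K HK].
  destruct (HX _ _ HK) as [X1 X2]. destruct (X1 x Hx) as [X3 X4]. specialize (X4 m ltac:(lia)).
  destruct (X2 false m ltac:(lia)) as [_ X5]. specialize (X5 x Hx). simpl in X5.
  pose proof HK as (_ & _ & _ & _ & HK'). destruct (HK' _ X4) as [Y1 Y2].
  exists phi', (K (iter m g (h x + phi' x)%C)). split; [auto|]. split.
  - constructor; auto. apply orb_agree_tail with (fun z => (h z + phi z)%C); auto.
    intros y Hy. unfold phi'. rewrite (Q4 y); [ring|apply in_or_app; auto|].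
    intros ->. inversion Hnd; contradiction.
  - intros Hin. set (p := K (iter m g (h x + phi' x)%C)) in *.
    (* The point [x] itself is not separated by [q]; returning to it would make [H x] a fixed point
       of [iter m g], hence [0]. *)
    destruct (excluded_middle_informative (p = x)) as [E|E].
    + rewrite E in Y2. destruct HG as (_ & HG & _). destruct (HG m ltac:(lia)) as (_ & _ & HG').
      symmetry in Y2. specialize (HG' Hm _ X3 Y2).
      destruct (good_bound _ _ _ _ _ _ x HK) as [B _]; [lra|]. simpl in B. rewrite HG', Cmod_0 in B.
      apply Hx0, Cmod_eq_0. pose proof (Cmod_ge_0 x). nra.
    + apply (Hbad p Hin). split; auto.
      replace (h p + phi p)%C with (h p + phi' p)%C; [exact Y2|].
      unfold phi'. rewrite (Q4 p); [ring|apply in_or_app; auto|auto].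
Qed.

(** An [a]-syllable is handled together with the [b]-syllable below it, hence the induction on a
    bound [n] for the length. The fixed [N] keeps the same [z0] admissible for all the shorter
    lists. *)
Lemma simple_orbit f g k l h Rb eps r Q c L r1 r2 rho P (z0 : C) N :
  0 < Rb -> 0 < eps -> 0 < c -> periodic_on f k r Q -> periodic_on g l r Q ->
  controlled f g k l r c L r1 r2 rho P ->
  (forall phi, small_entire Rb eps phi -> exists K, good c L r1 r2 (fun z => h z + phi z)%C K) ->
  z0 <> 0%C -> Cmod z0 < rho / P ^ N ->
  forall n s, (length s <= n)%nat -> (length s <= N)%nat -> reduced k l s ->
  exists phi x T, small_entire Rb eps phi /\ orb f g (fun z => h z + phi z)%C P z0 s x T /\
    x <> 0%C /\ NoDup (x :: T).
Proof.
  intros HRb Heps Hc PF PG HC HP Hz0 Hz.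
  pose proof HC as (Hrho & Hr & Hr1 & HP1 & HX & _).
  assert (Hpow : forall j, (j <= N)%nat -> Cmod z0 < rho / P ^ j).
  { intros j Hj. eapply Rlt_le_trans; [exact Hz|]. apply Rmult_le_compat_l; [lra|].
    apply Rinv_le_contravar; [apply pow_lt; lra|]. apply Rle_pow; auto. }
  assert (Hsize : forall phi s x T, small_entire Rb eps phi -> reduced k l s -> (length s <= N)%nat ->
    orb f g (fun z => h z + phi z)%C P z0 s x T -> Cmod x < rho).
  { intros phi s x T Hphi Hs HN Ho. destruct (HP phi Hphi) as [K HK].
    specialize (Hpow _ HN). rewrite (orb_eval _ _ _ _ _ _ _ _ _ _ _ _ _ _ _ _ _ Hc HC HK Hs Hpow Ho).
    destruct (syl_eval_control _ _ _ _ _ _ _ _ _ _ _ _ _ _ HC HK Hs) as [_ B].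
    eapply Rle_lt_trans; [apply B; auto|]. assert (0 < P ^ length s) by (apply pow_lt; lra).
    apply Rlt_le_trans with (P ^ length s * (rho / P ^ length s)); [apply Rmult_lt_compat_l; auto|].
    right; field; lra. }
  assert (Hsm0 : small_entire Rb eps (fun _ => 0%C)).
  { repeat split; [intros; apply holo_const|]. exists 0. split; [lra|]. intros; rewrite Cmod_0; lra. }
  assert (Hf0 : forall j v, (j <= k)%nat -> Cmod v < rho -> v <> 0%C -> iter j f v <> 0%C).
  { intros j v Hj Hv Hv0 E. apply Hv0. apply (periodic_on_injective f k r Q j); auto; try lra.
    - rewrite Cmod_0. lra.
    - rewrite E, iter_fixed; auto. apply PF. }
  assert (Hfix : forall j v, (0 < j < k)%nat -> Cmod v < rho -> v <> 0%C -> iter j f v <> v).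
  { intros j v Hj Hv Hv0 E. apply Hv0. destruct PF as (_ & PF & _).
    destruct (PF j ltac:(lia)) as (_ & _ & A). apply A; auto; lra. }
  induction n as [|n IH]; intros s Hn HN Hs.
  - destruct s; [|simpl in Hn; lia].
    exists (fun _ => 0%C), z0, nil. split; [auto|]. split; [constructor|]. split; [auto|].
    repeat constructor; auto.
  - destruct s as [|[b j] s']; [|destruct b].
    + apply IH; auto; simpl; lia.
    + destruct s' as [|[b m] s]; [|destruct b].
      (* A lone [a]-syllable offers nothing to perturb; the isolated fixed point of [iter j f]
         separates the two points of the orbit. *)
      * simpl in Hs. destruct Hs as (Hj & _).
        pose proof (Hpow 0%nat ltac:(lia)) as Hz1. simpl in Hz1.
        replace (rho / 1) with rho in Hz1 by field.
        exists (fun _ => 0%C), (iter j f z0), [z0]. split; [auto|]. split.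
        { constructor. constructor. }
        split; [apply Hf0; auto; lia|].
        repeat constructor; auto. intros [E|[]]. symmetry in E. revert E. apply Hfix; auto.
      * simpl in Hs. destruct Hs as (_ & Hb & _). contradiction.
      * simpl in Hn, HN.
        assert (Hs1 : reduced k l ((false, m) :: s)) by apply Hs.
        assert (Hj : (0 < j < k)%nat) by apply Hs.
        assert (Hm : (0 < m < l)%nat) by apply Hs1.
        assert (Hs2 : reduced k l s) by apply Hs1.
        destruct (IH s ltac:(lia) ltac:(lia) Hs2) as (phi & x & T & A1 & A2 & A3 & A4).
        assert (Hx : Cmod x < rho) by (apply (Hsize phi s x T); auto; lia).
        (* Avoiding [V] keeps [v] nonzero and new. Avoiding the image of [V] under [iter (k - j) f],
           the inverse of [iter j f], does the same for the next point [iter j f v]. *)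
        set (V := RtoC 0 :: x :: T).
        destruct (orb_extend_b f g k l h Rb eps r Q c L r1 r2 rho P phi z0 s x T m
                    (V ++ map (iter (k - j) f) V)) as (phi' & v & B1 & B2 & B3); auto.
        { destruct s as [|[b i] s']; [auto|destruct b; auto]. destruct Hs1 as (_ & Hb & _). congruence. }
        assert (Hv : Cmod v < rho) by (apply (Hsize phi' ((false, m) :: s) v (x :: T)); auto; simpl; lia).
        assert (HvV : ~ In v V) by (intros Hi; apply B3; apply in_or_app; auto).
        assert (HvW : ~ In (iter j f v) V).
        { intros Hi. apply B3. apply in_or_app; right. apply in_map_iff. exists (iter j f v). split; auto.
          rewrite <- iter_add. replace (k - j + j)%nat with k by lia. apply PF. lra. }
        assert (Hv0 : v <> 0%C) by (intros E; apply HvV; left; auto).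
        exists phi', (iter j f v), (v :: x :: T). split; [auto|]. split; [constructor; auto|].
        split; [apply Hf0; auto; lia|].
        constructor; [|constructor; auto].
        -- intros [E|Hi]; [symmetry in E; revert E; apply Hfix; auto|]. apply HvW. right; auto.
        -- intros Hi. apply HvV. right; auto.
    + rename s' into s. simpl in Hn, HN.
      assert (Hm : (0 < j < l)%nat) by apply Hs.
      assert (Hs2 : reduced k l s) by apply Hs.
      destruct (IH s ltac:(lia) ltac:(lia) Hs2) as (phi & x & T & A1 & A2 & A3 & A4).
      assert (Hx : Cmod x < rho) by (apply (Hsize phi s x T); auto; lia).
      destruct (orb_extend_b f g k l h Rb eps r Q c L r1 r2 rho P phi z0 s x T j (RtoC 0 :: x :: T))
        as (phi' & v & B1 & B2 & B3); auto.
      { destruct s as [|[b i] s']; [auto|destruct b; auto]. destruct Hs as (_ & Hb & _). congruence. }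
      exists phi', v, (x :: T). split; [auto|]. split; [auto|]. split.
      * intros E. apply B3. left; auto.
      * constructor; auto. intros Hi. apply B3. right; auto.
Qed.

Lemma word_moves_dense f g k l w :
  isDiff f -> isDiff g -> has_period f k -> has_period g l -> an_dense (word_moves f g k l w).
Proof.
  intros Hf Hg Pf Pg V HV [h [Hh HVh]].
  destruct (classic (pres_eq k l w nil)) as [Hw|Hw].
  { exists h. split; [auto|]. split; auto. intros Hn. contradiction. }
  assert (Hk : (0 < k)%nat) by (destruct Pf; auto). assert (Hl : (0 < l)%nat) by (destruct Pg; auto).
  pose proof (has_period_id f k Pf) as If. pose proof (has_period_id g l Pg) as Ig.
  destruct (normal_form k l w Hk Hl) as [s [Hs Es]].
  destruct (local_setup f g k l h Hf Hg Pf Pg Hh)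
    as (R0 & e0 & r & Q & c & L & r1 & r2 & rho & P & HR0 & He0 & Hc & H1 & H2 & PF & PG & HC & HP).
  pose proof HC as (Hrho & _ & _ & HP1 & _).
  destruct (HV h Hh HVh) as (h1 & rb & epsb & Hh1 & Hrb & Hepsb & Hb & HVb).
  destruct (basic_perturbation h1 rb epsb h Hh1 Hh Hb) as (phi1 & e1 & D1 & D2 & D3 & D4 & D5).
  (* The basic set inside [V] is centred at [h1], and [h - h1] already takes up [e1 < epsb]; only
     the remainder [epsb - e1] is available. *)
  set (Rb := Rmax R0 rb). set (eps := Rmin e0 (epsb - e1)).
  pose proof (Rmax_l R0 rb : R0 <= Rb). pose proof (Rmax_r R0 rb : rb <= Rb).
  pose proof (Rmin_l e0 (epsb - e1) : eps <= e0). pose proof (Rmin_r e0 (epsb - e1) : eps <= epsb - e1).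
  assert (Heps : 0 < eps) by (apply Rmin_pos; lra).
  assert (HP' : forall phi, small_entire Rb eps phi ->
            exists K, good c L r1 r2 (fun z => h z + phi z)%C K).
  { intros phi (A1 & A2 & e & He & A3). apply HP; auto.
    intros z Hz. specialize (A3 z ltac:(lra)). lra. }
  set (z0 := RtoC (rho / P ^ length s / 2)).
  assert (Hq : 0 < rho / P ^ length s) by (apply Rdiv_lt_0_compat; auto; apply pow_lt; lra).
  assert (Hz0 : Cmod z0 < rho / P ^ length s) by (unfold z0; rewrite Cmod_R, Rabs_right; lra).
  assert (Hz00 : z0 <> 0%C) by (intros E; apply RtoC_inj in E; lra).
  destruct (simple_orbit f g k l h Rb eps r Q c L r1 r2 rho P z0 (length s) ltac:(lra) Heps Hc PF PG HC HP'
              Hz00 Hz0 (length s) s (le_n _) (le_n _) Hs) as (phi & x & T & A1 & A2 & A3 & A4).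
  destruct (HP' phi A1) as [K HK].
  destruct (good_germs _ _ _ _ _ _ Hc H1 H2 HK) as (G1 & G2 & G3).
  (* The list [s] is nonempty, so [z0] sits in [T], strictly before the endpoint [x], and [NoDup]
     separates them. *)
  assert (Hx : x <> z0).
  { destruct s as [|sy s']; [exfalso; apply Hw; exact Es|].
    assert (Hin : forall s x T, orb f g (fun z => h z + phi z)%C P z0 s x T -> In z0 (x :: T)).
    { clear. induction 1; simpl in *; auto. }
    intros E. inversion A4 as [|y T' Hni _]. apply Hni. rewrite E.
    clear - A2 Hin. inversion A2; subst; eapply Hin; eassumption. }
  assert (Hdiff : isDiff (fun z => h z + phi z)%C).
  { destruct G1 as [G10 [rh [Hrh G11]]]. split; [exists rh; split; auto; apply holo_on_disc; auto|].
    split; auto. exists K. destruct G2 as [G20 [rk [Hrk G21]]]. split; [|split; [|split]]; auto.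
    - exists rk. split; auto. apply holo_on_disc; auto.
    - pose proof HK as (_ & _ & Hbi & _ & HHK).
      destruct (germ0_small (fun z => h z + phi z)%C r2) as [d [Hd Hd']]; auto.
      { split; auto. exists rh; auto. }
      exists (Rmin d r1). split; [apply Rmin_pos; auto|]. intros z Hz.
      pose proof (Rmin_l d r1). pose proof (Rmin_r d r1).
      destruct (HHK _ (Hd' z ltac:(lra))) as [Y1 Y2].
      destruct (Hbi (K (h z + phi z)%C) z Y1 ltac:(lra)) as [B _]. rewrite Y2 in B.
      replace (h z + phi z - (h z + phi z))%C with (RtoC 0) in B by ring. rewrite Cmod_0 in B.
      apply Cmod_sub_eq0. pose proof (Cmod_ge_0 (K (h z + phi z)%C - z)). nra. }
  exists (fun z => h z + phi z)%C. split; [auto|]. split.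
  - apply HVb; auto. destruct A1 as (B1 & B2 & e & He & B3).
    apply basic_intro with (fun z => phi1 z + phi z)%C (e1 + e); auto.
    + apply holo_plus; auto.
    + destruct D3 as [d [Hd D3]]. exists d. split; auto. intros z Hz. rewrite D3 by auto. ring.
    + lra.
    + intros z Hz. eapply Rle_trans; [apply Cmod_triangle|].
      specialize (D5 z Hz). specialize (B3 z ltac:(lra)). lra.
  - intros _ fi gi hi Ifi Igi Ihi Hid.
    apply (eval_word_syl f g _ fi gi hi k l w s (fun z => h z + phi z)%C K) in Hid; auto using germ_eq_refl.
    pose proof (syl_eval_identity _ _ _ _ _ _ _ _ _ _ _ _ _ _ HC HK Hs Hid z0 Hz0) as E.
    apply Hx. rewrite <- E. apply (orb_eval _ _ _ _ _ _ _ _ _ _ _ _ _ _ _ _ _ Hc HC HK Hs Hz0 A2).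
Qed.

(** * Enumeration of the words and conclusion *)

Definition letter_code (x : letter) : nat :=
  match x with (true, true) => 1 | (true, false) => 2 | (false, true) => 3 | (false, false) => 4 end.

(* Bijective base-4 numeration. *)
Fixpoint word_code (w : word) : nat :=
  match w with nil => 0 | x :: t => 4 * word_code t + letter_code x end.

Lemma word_code_inj u v : word_code u = word_code v -> u = v.
Proof.
  revert v. induction u as [|[[] []] u IH]; intros [|[[] []] v] E; simpl in E; try lia; auto;
    f_equal; apply IH; lia.
Qed.

Theorem theorem4p2 :
  forall (f g : C -> C) (k l : nat),
    isDiff f -> isDiff g -> has_period f k -> has_period g l ->
    exists U : nat -> (C -> C) -> Prop,
      (forall n, an_open (U n) /\ an_dense (U n)) /\
      forall h, isDiff h -> (forall n, U n h) ->
        forall fi gi hi, germ_inv f fi -> germ_inv g gi -> germ_inv h hi ->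
          forall w : word,
            germ_id (eval_word f fi (fun z => hi (g (h z))) (fun z => hi (gi (h z))) w)
            <-> pres_eq k l w nil.
Proof.
  intros f g k l Hf Hg Pf Pg.
  (* Injectivity of the code leaves at most one word for each [n], so no decoding has to be
     chosen. *)
  exists (fun n h => forall w, word_code w = n -> word_moves f g k l w h). split.
  - intros n.
    destruct (classic (exists w, word_code w = n)) as [[w <-]|Hn].
    + assert (E : forall h, word_moves f g k l w h ->
                forall v, word_code v = word_code w -> word_moves f g k l v h).
      { intros h H v Ev. apply word_code_inj in Ev. subst v. exact H. }
      split.
      * intros h Hh HU.
        destruct (word_moves_open f g k l w Hf Hg Pf Pg h Hh (HU w eq_refl))
          as (h1 & r & eps & A1 & A2 & A3 & A4 & A5).
        exists h1, r, eps. repeat (split; [assumption|]). auto.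
      * intros V HV Hne.
        destruct (word_moves_dense f g k l w Hf Hg Pf Pg V HV Hne) as (h & A1 & A2 & A3).
        exists h. auto.
    + split.
      * intros h Hh HU. exists h, 1, 1. split; [auto|]. split; [lra|]. split; [lra|].
        split; [apply basic_refl; lra|]. intros h' _ _ w Hw. exfalso; eauto.
      * intros V HV [h [Hh HVh]]. exists h. split; [auto|]. split; auto.
        intros w Hw. exfalso; eauto.
  - intros h Hh HU fi gi hi Ifi Igi Ihi w. split.
    + intros Hid. apply NNPP. intros Hw. exact (HU _ w eq_refl Hw fi gi hi Ifi Igi Ihi Hid).
    + intros Hw. apply (conjugate_sound f g h fi gi hi k l w nil); auto using has_period_id.
Qed.
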